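(* Let $\Phi$ be an irreducible crystallographic root system, let $\mathbf s_0\in\mathbb C^{\Psi^+}$, and let $\gamma(t)=\mathbf s_0+t\mathbf v$ be an affine curve transverse to every carrier hyperplane incident at $\mathbf s_0$; put $c_w=(\Lambda_w\circ\gamma)'(0)\neq0$ for each incident carrier $w=(S,\ell)$. With $C_{\mathfrak F}$ the holomorphic coefficients of the local normal form of $Z_\Phi$ near $\mathbf s_0$, define for every integer $m\ge1$ $$\mathcal A_m(\gamma)=\sum_{|\mathfrak F|\ge m}\frac{\left.\dfrac{d^{|\mathfrak F|-m}}{dt^{|\mathfrak F|-m}}C_{\mathfrak F}(\gamma(t))\right|_{t=0}}{(|\mathfrak F|-m)!\prod_{w\in\mathfrak F}c_w},$$ the sum being over the flags $\mathfrak F$ incident at $\mathbf s_0$ of length $|\mathfrak F|\ge m$. Then $$[t^{-m}]Z_\Phi(\gamma(t))=\mathcal A_m(\gamma),\qquad \operatorname{pord}_{t=0}Z_\Phi(\gamma(t))=\max\{m:\mathcal A_m(\gamma)\neq0\}.$$ Here $\max\varnothing:=0$; when every $\mathcal A_m(\gamma)$ with $m\ge1$ vanishes, the pullback extends holomorphically across $t=0$ and the pole order is zero. In particular, with $\delta_{\mathfrak F}=\operatorname{ord}_{t=0}C_{\mathfrak F}(\gamma(t))$ ($+\infty$ for the zero germ), $$\operatorname{pord}_{t=0}Z_\Phi(\gamma(t))\le\max_{\mathfrak F}(|\mathfrak F|-\delta_{\mathfrak F})_+.$$ Equality in this bound holds exactly when the aggregate $\mathcal A_m(\gamma)$ at the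 maximal candidate order $m=\max_{\mathfrak F}(|\mathfrak F|-\delta_{\mathfrak F})_+$ is nonzero.
   Context: Write $\mathbb N=\{1,2,\dots\}$, $\mathbb N_0=\{0,1,\dots\}$. Let $\Psi=\Phi^\vee$, $\Psi^+$ the positive coroots, $\beta_1,\dots,\beta_r$ the simple coroots, $I=\{1,\dots,r\}$. For $\alpha=\sum_i b_i(\alpha)\beta_i\in\Psi^+$, $\operatorname{supp}(\alpha)=\{i:b_i(\alpha)\neq0\}$, $L_\alpha(\mathbf m)=\sum_ib_i(\alpha)m_i$. $Z_\Phi(\mathbf s)$ is the meromorphic continuation of $\sum_{\mathbf m\in\mathbb N^r}\prod_{\alpha\in\Psi^+}L_\alpha(\mathbf m)^{-s_\alpha}$ to $\mathbb C^{\Psi^+}$. For nonempty $S\subseteq I$, $\ell\in\mathbb N_0$: $R(S)=\{\alpha\in\Psi^+:\operatorname{supp}(\alpha)\cap S\ne\varnothing\}$, $\Lambda_{S,\ell}(\mathbf s)=\sum_{\alpha\in R(S)}s_\alpha-|S|+\ell$; the carrier hyperplane is $H_{S,\ell}=\{\Lambda_{S,\ell}=0\}$, incident at $\mathbf s_0$ if $\Lambda_{S,\ell}(\mathbf s_0)=0$. A strict decorated support flag is $\mathfrak F=((S_1,\ell_1),\dots,(S_k,\ell_k))$ with $\varnothing\neq S_1\subsetneq\cdots\subsetneq S_k\subseteq I$, $\ell_j\in\mathbb N_0$, of length $|\mathfrak F|=k$; it is incident at $\mathbf s_0$ if all its carriers are. Local normal form: near $\mathbf s_0$, $Z_\Phi(\mathbf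 s)=H(\mathbf s)+\sum_{\mathfrak F}C_{\mathfrak F}(\mathbf s)\prod_{(S,\ell)\in\mathfrak F}\Lambda_{S,\ell}(\mathbf s)^{-1}$, a finite sum over flags incident at $\mathbf s_0$, with $H$ and $C_{\mathfrak F}$ holomorphic (such an expansion always exists). $\operatorname{pord}$ denotes pole order, $[t^{-m}]$ the Laurent coefficient at $t=0$, and $x_+=\max(x,0)$. *)

(* Defs.v *)
From HB Require Import structures.
From mathcomp Require Import all_boot all_order all_algebra finmap.
From mathcomp Require Import complex.
From mathcomp Require Import all_classical all_reals all_analysis.

Set Implicit Arguments.
Unset Strict Implicit.
Unset Printing Implicit Defensive.

Import Order.TTheory GRing.Theory Num.Theory.
Import numFieldNormedType.Exports.

Local Open Scope classical_set_scope.
Local Open Scope ring_scope.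
Local Open Scope complex_scope.

(* R[i]^o is R[i] seen as a normed module over itself: this is the form in
   which the topology, [differentiable] and [derive1n] are over the complex
   numbers. *)
Notation Cplx R := (R[i]^o).

Section RootSystems.
Variables (R : realType) (r : nat).
Implicit Types (a b x : 'rV[R]_r) (Phi : seq 'rV[R]_r).

Definition dotv a b : R := \sum_(i < r) a 0 i * b 0 i.

Definition coroot a : 'rV[R]_r := (2 / dotv a a) *: a.

(* Reduced crystallographic root systems of rank r in Euclidean space R^r;
   the finite set of roots is listed without repetition. *)
Record root_system Phi : Prop := RootSystem {
  roots_uniq : uniq Phi;
  roots_span : (<<Phi>> = fullv)%VS;
  roots_neq0 : 0 \notin Phi;
  roots_reduced : forall a (c : R),
    a \in Phi -> c *: a \in Phi -> c = 1 \/ c = -1;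
  roots_refl : forall a b,
    a \in Phi -> b \in Phi -> b - dotv b (coroot a) *: a \in Phi;
  roots_int : forall a b,
    a \in Phi -> b \in Phi -> dotv b (coroot a) \is a Num.int }.

Definition irreducible_roots Phi : Prop :=
  Phi <> [::] /\
  forall P : pred 'rV[R]_r,
    (forall a b, a \in Phi -> b \in Phi -> P a -> ~~ P b -> dotv a b = 0) ->
    all P Phi \/ all (predC P) Phi.

Record simple_system Phi (Delta : r.-tuple 'rV[R]_r) : Prop := SimpleSystem {
  simple_sub : {subset Delta <= Phi};
  simple_basis : basis_of fullv Delta;
  simple_sign : forall a, a \in Phi -> exists n : 'I_r -> nat,
    a = \sum_i tnth Delta i *+ n i \/ a = - \sum_i tnth Delta i *+ n i }.

Definition positive_coroots Phi (Delta : r.-tuple 'rV[R]_r) : seq 'rV[R]_r :=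
  [seq coroot a | a <- Phi & [forall i, 0 <= coord Delta i a]].

Definition simple_coroots (Delta : r.-tuple 'rV[R]_r) : r.-tuple 'rV[R]_r :=
  [tuple of map coroot Delta].

End RootSystems.

Section ComplexAnalysis.
Variable R : realType.
Local Notation C := (Cplx R).

Definition cpowR (x : R) (s : C) : C :=
  (expR (complex.Re s * ln x))%:C *
  (cos (complex.Im s * ln x) +i* sin (complex.Im s * ln x)).

Definition holomorphic_at (V : normedModType C) (f : V -> C) (p : V) : Prop :=
  \forall s \near p, differentiable f s.

(* A meromorphic function is encoded as a total function whose values at the
   points where it is not holomorphic are meaningless.  The second clause
   excludes removable singularities, so that [~ holomorphic_at f p] says
   exactly that p is in the polar set. *)
Definition meromorphic (V : normedModType C) (f : V -> C) : Prop :=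
  (forall p : V, exists g h : V -> C,
     [/\ holomorphic_at g p, holomorphic_at h p,
         ~ (\forall s \near p, h s = 0) &
         \forall s \near p, h s != 0 ->
           holomorphic_at f s /\ f s = g s / h s]) /\
  (forall (p : V) (g : V -> C), holomorphic_at g p ->
     (\forall s \near p, holomorphic_at f s -> f s = g s) ->
     holomorphic_at f p).

(* [laurent_expansion f a]: f(t) is the sum of a_k t^k over k >= -N, for some
   N, in a punctured neighbourhood of 0. *)
Definition laurent_expansion (f : C -> C) (a : int -> C) : Prop :=
  exists N : nat, (forall k : int, k < - N%:Z -> a k = 0) /\
    \forall t \near 0^',
      series (fun n : nat => a (n%:Z - N%:Z) * t ^ (n%:Z - N%:Z)) @ \oo --> f t.

Definition laurent_coef (f : C -> C) (k : int) : C :=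
  xget 0 [set c | exists2 a, laurent_expansion f a & c = a k].

Definition extends_holomorphically (f : C -> C) : Prop :=
  exists2 g : C -> C, holomorphic_at g 0 & \forall t \near 0^', f t = g t.

Definition has_pole_order (f : C -> C) (n : nat) : Prop :=
  if n is 0 then extends_holomorphically f
  else exists g : C -> C, [/\ holomorphic_at g 0, g 0 != 0 &
         \forall t \near 0^', f t = g t / t ^+ n].

Definition pole_order (f : C -> C) : nat := xget 0%N [set n | has_pole_order f n].

Definition has_zero_order (f : C -> C) (n : nat) : Prop :=
  exists g : C -> C, [/\ holomorphic_at g 0, g 0 != 0 &
    \forall t \near (0 : C), f t = t ^+ n * g t].

(* [None] stands for the order +oo of the zero germ. *)
Definition zero_order (f : C -> C) : option nat :=
  if `[< \forall t \near (0 : C), f t = 0 >] then None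
  else Some (xget 0%N [set n | has_zero_order f n]).

(* Largest element, with max set0 = 0. *)
Definition nat_max (A : set nat) : nat :=
  xget 0%N [set n | A n /\ forall k, A k -> (k <= n)%N].

End ComplexAnalysis.

(* Positive coroots are referred to by their index j in the list
   [positive_coroots Phi Delta], and a point s of C^(Psi^+) is the row vector
   of its coordinates s 0 j. *)
Notation zeta_space R Phi Delta :=
  ('rV[Cplx R]_(size (positive_coroots Phi Delta))) (only parsing).

(* Pairs (S, l), and finite sequences of such pairs. *)
Notation carrier r := ({set 'I_r} * nat)%type (only parsing).
Notation flag r := (seq (carrier r)) (only parsing).

Section RootSystemZeta.
Variables (R : realType) (r : nat).
Variables (Phi : seq 'rV[R]_r) (Delta : r.-tuple 'rV[R]_r).
Local Notation C := (Cplx R).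
Local Notation Psi := (positive_coroots Phi Delta).
Local Notation V := (zeta_space R Phi Delta).

Definition ccoef (j : 'I_(size Psi)) (i : 'I_r) : R :=
  coord (simple_coroots Delta) i (tnth (in_tuple Psi) j).

Definition csupp (j : 'I_(size Psi)) : {set 'I_r} := [set i | ccoef j i != 0].

Definition Lform (j : 'I_(size Psi)) (m : 'I_r -> nat) : R :=
  \sum_i ccoef j i * (m i)%:R.

Definition zeta_term (s : V) (m : 'I_r -> nat) : C :=
  \prod_j cpowR (Lform j m) (- s 0 j).

(* Since m ranges over vectors of positive integers, the box {1..n}^r is
   indexed by functions 'I_r -> 'I_n shifted by one. *)
Definition zeta_partial (s : V) (n : nat) : C :=
  \sum_(m : {ffun 'I_r -> 'I_n}) zeta_term s (fun i => (m i).+1).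

Definition zeta_abs_cvg (s : V) : Prop :=
  exists M : C, forall n : nat,
    \sum_(m : {ffun 'I_r -> 'I_n}) `|zeta_term s (fun i => (m i).+1)| <= M.

(* Z is the meromorphic continuation of the Dirichlet series from the interior
   of its domain of absolute convergence; it is unique off its polar set. *)
Definition zeta_continuation (Z : V -> C) : Prop :=
  meromorphic Z /\
  forall s, (\forall s' \near s, zeta_abs_cvg s') ->
    zeta_partial s @ \oo --> Z s.

Definition Rset (S : {set 'I_r}) : {set 'I_(size Psi)} :=
  [set j | csupp j :&: S != finset.set0].

Definition Lambda (w : carrier r) (s : V) : C :=
  \sum_(j in Rset w.1) s 0 j - #|w.1|%:R + w.2%:R.

Definition incident (s0 : V) (w : carrier r) : Prop :=
  w.1 != finset.set0 /\ Lambda w s0 = 0.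

Definition is_flag (F : flag r) : Prop :=
  [/\ F <> [::], all (fun w : carrier r => w.1 != finset.set0) F &
      sorted (fun w w' : carrier r => w.1 \proper w'.1) F].

Definition incident_flags (s0 : V) : set (flag r) :=
  [set F | is_flag F /\ forall w, w \in F -> incident s0 w].

(* The identity between meromorphic germs is evaluated at the points near s0
   off the incident carriers, where its right-hand side is holomorphic. *)
Definition local_normal_form (Z : V -> C) (s0 : V)
    (H : V -> C) (Cf : flag r -> V -> C) : Prop :=
  [/\ holomorphic_at H s0,
      forall F, incident_flags s0 F -> holomorphic_at (Cf F) s0 &
      \forall s \near s0, (forall w, incident s0 w -> Lambda w s != 0) ->
        Z s = H s +
          \sum_(F \in incident_flags s0) Cf F s / \prod_(w <- F) Lambda w s].

Definition line (s0 v : V) (t : C) : V := s0 + t *: v.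

Definition cslope (s0 v : V) (w : carrier r) : C :=
  derive1 (fun t : C => Lambda w (line s0 v t)) 0.

Definition transverse (s0 v : V) : Prop :=
  forall w, incident s0 w -> cslope s0 v w != 0.

Definition aggregate (s0 v : V) (Cf : flag r -> V -> C) (m : nat) : C :=
  \sum_(F \in incident_flags s0 `&` [set F | (m <= size F)%N])
    derive1n (size F - m) (fun t : C => Cf F (line s0 v t)) 0 /
    ((size F - m)`!%:R * \prod_(w <- F) cslope s0 v w).

(* (|F| - delta_F)_+, with |F| - oo = -oo; subtraction on nat truncates at 0. *)
Definition flag_excess (s0 v : V) (Cf : flag r -> V -> C) (F : flag r) : nat :=
  if zero_order (fun t : C => Cf F (line s0 v t)) is Some d
  then (size F - d)%N else 0%N.

Definition max_excess (s0 v : V) (Cf : flag r -> V -> C) : nat :=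
  nat_max [set flag_excess s0 v Cf F | F in incident_flags s0].

End RootSystemZeta.

(* Main.v *)
Require Import Defs.
From mathcomp Require Import all_boot all_order all_algebra.
From mathcomp Require Import complex.
From mathcomp Require Import all_classical all_reals all_analysis.
From mathcomp Require Import ring lra zify.
Import Order.TTheory GRing.Theory Num.Theory.
Import numFieldNormedType.Exports.
Local Open Scope classical_set_scope.
Local Open Scope ring_scope.

Set Implicit Arguments.
Unset Strict Implicit.
Unset Printing Implicit Defensive.

(* Along the line every incident carrier equals [t] times its nonzero slope, so
   the pullback is [G t / t ^+ N] with [N] the maximal length of an incident
   flag and [G] holomorphic at 0.  Comparing Taylor coefficients of [G] with
   those of the [C_F] identifies the principal part with the aggregates, and the
   pole order is read off the first nonvanishing Taylor coefficient of [G].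

   This rests on the fact that a function of one complex variable which is
   differentiable near a point is the sum of its Taylor series there.  Goursat's
   bisection is applied to bilinear images of the unit square, with integrals
   over segments replaced by dyadic midpoint means: bisecting a segment only
   shifts the level of the mean, so no integration theory is needed.  Cauchy's
   formula on a square contour, the derivatives of Cauchy integrals and the
   expansion of the Cauchy kernel then give the Taylor series. *)

(** [holomorphic_at] asks only for complex differentiability at nearby points, with no continuity of
    the derivative; this is why the argument starts from Goursat. Bilinear images are forced by the
    contour deformation: the region between a square and a small copy of it placed around an
    off-centre point [w] splits into four trapezoids, which are not parallelograms. A bilinear map
    still sends dyadic subsquares to quadrilaterals with straight edges, of diameter proportional to
    the side. The contour integral of [1/z] is never evaluated: it occurs as a common factor, so its
    nonvanishing suffices. Taylor expansions are carried as explicit geometric bounds on all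
    remainders, a form stable under sums and under multiplication and division by powers of [t].
    Contributions of different flags to an aggregate can cancel, so the vanishing orders of the
    single coefficients bound the pole order only from above. *)

Section Modulus.
Variable R : realType.
Implicit Types z w : R[i].

(** The norm of [R[i]] takes values in [R[i]] itself; a modulus in [R] puts estimates within reach
    of [lra] and [nra]. *)
Definition cmod z : R := Normc.normc z.

Lemma norm_cmod z : `|z| = (cmod z)%:C%C.
Proof. by []. Qed.

Lemma cmod_ge0 z : 0 <= cmod z.
Proof. by have := normr_ge0 z; rewrite norm_cmod lecR. Qed.

Lemma cmod0 : cmod 0 = 0. Proof. exact: Normc.normc0. Qed.
Lemma cmod1 : cmod 1 = 1. Proof. exact: Normc.normc1. Qed.

Lemma cmodM z w : cmod (z * w) = cmod z * cmod w.
Proof. exact: Normc.normcM. Qed.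

Lemma cmodD z w : cmod (z + w) <= cmod z + cmod w.
Proof. exact: le_normcD. Qed.

Lemma cmodN z : cmod (- z) = cmod z.
Proof. exact: normcN. Qed.

Lemma cmodC z w : cmod (z - w) = cmod (w - z).
Proof. by rewrite -cmodN opprB. Qed.

Lemma cmodV z : cmod z^-1 = (cmod z)^-1.
Proof. exact: Normc.normcV. Qed.

Lemma cmodX z n : cmod (z ^+ n) = cmod z ^+ n.
Proof. by elim: n => [|n IH]; rewrite ?expr0 ?cmod1// !exprS cmodM IH. Qed.

Lemma cmod_eq0 z : (cmod z == 0) = (z == 0).
Proof.
by apply/eqP/eqP => [/Normc.eq0_normc//|->]; exact: cmod0.
Qed.

Lemma cmod_gt0 z : (0 < cmod z) = (z != 0).
Proof. by rewrite lt_neqAle cmod_ge0 andbT eq_sym cmod_eq0. Qed.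

Lemma cmodR (x : R) : cmod x%:C%C = `|x|.
Proof. by rewrite /cmod /Normc.normc/= expr0n /= addr0 sqrtr_sqr. Qed.

Lemma cmod_nat n : cmod n%:R = n%:R.
Proof.
have -> : n%:R = (n%:R : R)%:C%C by rewrite rmorph_nat.
by rewrite cmodR ger0_norm.
Qed.

Lemma cmod_sum (I : Type) (r : seq I) (P : pred I) (F : I -> R[i]) :
  cmod (\sum_(i <- r | P i) F i) <= \sum_(i <- r | P i) cmod (F i).
Proof.
elim/big_rec2: _ => [|i x y _ h]; first by rewrite cmod0.
by apply: le_trans (cmodD _ _) _; rewrite lerD2l.
Qed.

Lemma Re_le_cmod z : `|complex.Re z| <= cmod z.
Proof. by have := normc_ge_Re z; rewrite norm_cmod lecR. Qed.

Lemma cmod_i : cmod 'i%C = 1.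
Proof. by rewrite /cmod /Normc.normc /= expr0n expr1n add0r sqrtr1. Qed.

Lemma Im_le_cmod z : `|complex.Im z| <= cmod z.
Proof.
have := Re_le_cmod (z * 'i%C); rewrite ReiNIm normrN => h.
by apply: le_trans h _; rewrite cmodM cmod_i mulr1.
Qed.

Lemma cmod_leD z w (a b : R) : cmod z <= a -> cmod w <= b -> cmod (z + w) <= a + b.
Proof. by move=> h1 h2; apply: le_trans (cmodD _ _) _; apply: lerD. Qed.

Lemma cmod_leB z w (a b : R) : cmod z <= a -> cmod w <= b -> cmod (z - w) <= a + b.
Proof. by move=> h1 h2; apply: cmod_leD; rewrite ?cmodN. Qed.

Lemma cmod_geB z w : cmod z - cmod w <= cmod (z - w).
Proof. by have := cmodD (z - w) w; rewrite subrK; lra. Qed.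

(** Radii of balls in [Cplx R] are positive elements of [R[i]], hence real; replacing them by their
    real part gives an ordinary epsilon-delta form. *)
Lemma near_cmodP (a : Cplx R) (P : Cplx R -> Prop) :
  (\forall t \near a, P t) <->
  exists2 d : R, 0 < d & forall t, cmod (t - a) < d -> P t.
Proof.
split.
- move=> /nbhs_normP [e /= e0 h].
  have e0' : e = (complex.Re e)%:C%C by rewrite RRe_real// ger0_real// ltW.
  exists (complex.Re e); first by move: e0; rewrite {1}e0' ltcR.
  move=> t ht; apply: h => /=; rewrite distrC norm_cmod e0' ltcR//.
- move=> [d d0 h]; apply/nbhs_normP; exists d%:C%C; first by rewrite /= ltcR.
  by move=> t /=; rewrite distrC norm_cmod ltcR => /h.
Qed.

Lemma near0_cmodP (P : Cplx R -> Prop) :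
  (\forall t \near 0^', P t) <->
  exists2 d : R, 0 < d & forall t, t != 0 -> cmod t < d -> P t.
Proof.
rewrite /dnbhs; split.
- move=> /near_cmodP [d d0 h]; exists d => // t t0 ht.
  by apply: h => //; rewrite subr0.
- move=> [d d0 h]; apply/near_cmodP; exists d => // t; rewrite subr0 => ht t0.
  exact: h.
Qed.

End Modulus.

(** * Goursat's theorem by bisection *)

Section Bisection.
Variable R : realType.
Implicit Types x y p q : R.

(** Here [x n] is the left end of a nested interval of length [2^-n]. Right ends decrease, so each
    of them bounds all left ends, and the supremum of the left ends lies in every interval. *)
Lemma nested_limit (x : nat -> R) :
  (forall n, x n <= x n.+1 <= x n + 2^-1 ^+ n.+1) ->
  exists p, forall n, x n <= p <= x n + 2^-1 ^+ n.
Proof.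
move=> hx.
have up n : 2^-1 ^+ n = 2^-1 ^+ n.+1 + 2^-1 ^+ n.+1 :> R by rewrite exprS; field.
have mono k n : x n <= x (n + k)%N.
  elim: k => [|k IH]; first by rewrite addn0.
  by rewrite addnS; apply: le_trans IH _; case/andP: (hx (n + k)%N).
have bnd k n : x (n + k)%N + 2^-1 ^+ (n + k) <= x n + 2^-1 ^+ n.
  elim: k => [|k IH]; first by rewrite addn0.
  rewrite addnS; apply: le_trans IH.
  by have := hx (n + k)%N; have := up (n + k)%N; lra.
have e0 n : 0 <= 2^-1 ^+ n :> R by apply: exprn_ge0; lra.
have ub n : ubound (range x) (x n + 2^-1 ^+ n).
  move=> _ [m _ <-]; have [/subnKC <-|/ltnW/subnKC <-] := leqP n m.
    have := bnd (m - n)%N n; have := e0 (n + (m - n))%N; lra.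
  have := mono (n - m)%N m; have := e0 (m + (n - m))%N; lra.
have hs : has_sup (range x).
  split; first by exists (x 0%N), 0%N.
  by exists (x 0%N + 2^-1 ^+ 0).
exists (sup (range x)) => n; apply/andP; split.
  by apply: ub_le_sup; [case: hs|exists n].
by apply: ge_sup; [case: hs|exact: ub].
Qed.

(** Compactness of the unit square as an induction principle. If [P] failed on the whole square it
    would fail on one quarter, then on a quarter of that one, and so on; these squares close down on
    a point, where the local hypothesis is contradicted. *)
Lemma bisection2 (P : nat -> R -> R -> Prop) :
  (forall n x y, let h := 2^-1 ^+ n.+1 in
     P n.+1 x y -> P n.+1 (x + h) y -> P n.+1 x (y + h) ->
     P n.+1 (x + h) (y + h) -> P n x y) ->
  (forall p q, 0 <= p <= 1 -> 0 <= q <= 1 ->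
     exists n, forall x y, let h := 2^-1 ^+ n in
       0 <= x -> x + h <= 1 -> 0 <= y -> y + h <= 1 ->
       x <= p <= x + h -> y <= q <= y + h -> P n x y) ->
  P 0%N 0 0.
Proof.
move=> hs hloc; apply: contrapT => nP0.
(* The failure of [P] is assumed under the existential so that the choice function [g] is total. *)
have next n (u : R * R) : exists u' : R * R, ~ P n u.1 u.2 ->
    [/\ ~ P n.+1 u'.1 u'.2, u'.1 = u.1 \/ u'.1 = u.1 + 2^-1 ^+ n.+1 &
        u'.2 = u.2 \/ u'.2 = u.2 + 2^-1 ^+ n.+1].
  case: u => x y /=.
  case: (pselect (P n.+1 x y)) => [h1|h1]; last by exists (x, y) => _; split=> //; left.
  case: (pselect (P n.+1 (x + 2^-1 ^+ n.+1) y)) => [h2|h2]; last first.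
    by exists (x + 2^-1 ^+ n.+1, y) => _; split=> //; [right|left].
  case: (pselect (P n.+1 x (y + 2^-1 ^+ n.+1))) => [h3|h3]; last first.
    by exists (x, y + 2^-1 ^+ n.+1) => _; split=> //; [left|right].
  exists (x + 2^-1 ^+ n.+1, y + 2^-1 ^+ n.+1) => nP; split; [|by right|by right].
  by move=> h4; apply: nP; exact: hs.
pose g n u := projT1 (cid (next n u)).
have gP n u := projT2 (cid (next n u)).
pose u := fix u n := if n is m.+1 then g m (u m) else (0, 0).
have nP n : ~ P n (u n).1 (u n).2.
  by elim: n => [//|n IH]; case: (gP n (u n) IH).
have e0 n : 0 <= 2^-1 ^+ n :> R by apply: exprn_ge0; lra.
have u1 n : (u n).1 <= (u n.+1).1 <= (u n).1 + 2^-1 ^+ n.+1.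
  by have := e0 n.+1; case: (gP n (u n) (nP n)) => _ [] /= -> _; lra.
have u2 n : (u n).2 <= (u n.+1).2 <= (u n).2 + 2^-1 ^+ n.+1.
  by have := e0 n.+1; case: (gP n (u n) (nP n)) => _ _ [] /= ->; lra.
have up n : 2^-1 ^+ n = 2^-1 ^+ n.+1 + 2^-1 ^+ n.+1 :> R by rewrite exprS; field.
have inb n : [/\ 0 <= (u n).1, (u n).1 + 2^-1 ^+ n <= 1,
                 0 <= (u n).2 & (u n).2 + 2^-1 ^+ n <= 1].
  elim: n => [|n [h1 h2 h3 h4]]; first by rewrite /= expr0; split; lra.
  by have := u1 n; have := u2 n; have := up n; split; lra.
have [p hp] := nested_limit u1; have [q hq] := nested_limit u2.
have p01 : 0 <= p <= 1.
  by have := hp 0%N; rewrite /= expr0; lra.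
have q01 : 0 <= q <= 1.
  by have := hq 0%N; rewrite /= expr0; lra.
have [n hn] := hloc p q p01 q01.
by apply: (nP n); have [] := inb n => *; apply: hn.
Qed.

Lemma bisection1 (P : nat -> R -> Prop) :
  (forall n x, P n.+1 x -> P n.+1 (x + 2^-1 ^+ n.+1) -> P n x) ->
  (forall p, 0 <= p <= 1 ->
     exists n, forall x, let h := 2^-1 ^+ n in
       0 <= x -> x + h <= 1 -> x <= p <= x + h -> P n x) ->
  P 0%N 0.
Proof.
move=> hs hloc; apply: (@bisection2 (fun n x _ => P n x)).
  by move=> n x y h h1 h2 _ _; exact: hs.
move=> p q hp _; have [n hn] := hloc p hp.
by exists n => x y h *; exact: hn.
Qed.

Lemma small_pow2 (e : R) : 0 < e -> exists n, 2^-1 ^+ n < e.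
Proof.
move=> e0; have h : 2^-1 ^+ n @[n --> \oo] --> (0 : R).
  by apply: cvg_expr; rewrite ger0_norm; lra.
move/cvgrPdist_lt: h => /(_ e e0) [n _ /(_ n)] /=.
rewrite leqnn => /(_ isT); rewrite sub0r normrN ger0_norm; first by exists n.
by apply: exprn_ge0; lra.
Qed.

End Bisection.

(** * Limits of complex sequences and dyadic midpoint means *)

Section MidpointMeans.
Variable R : realType.
Local Notation C := R[i].
Local Notation "x %:K" := (x%:C%C : C) (at level 1, format "x %:K").
Implicit Types (g k : R -> C) (u : nat -> C).

Definition clim u (l : C) :=
  forall e : R, 0 < e -> exists N, forall n, (N <= n)%N -> cmod (u n - l) <= e.

Lemma clim_uniq u (l l' : C) : clim u l -> clim u l' -> l = l'.
Proof.
move=> h h'; apply/eqP; rewrite -subr_eq0 -cmod_eq0; apply/negPn/negP => n0.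
have e0 : 0 < cmod (l - l') / 3.
  by rewrite divr_gt0// lt_neqAle eq_sym n0 cmod_ge0.
have [N hN] := h _ e0; have [N' hN'] := h' _ e0.
have := hN _ (leq_maxl N N'); have := hN' _ (leq_maxr N N').
set n := maxn N N' => h1 h2.
have : cmod (l - l') <= cmod (l - l') / 3 + cmod (l - l') / 3.
  have {1}-> : l - l' = (u n - l') - (u n - l) by ring.
  exact: cmod_leB.
lra.
Qed.

Lemma clim_cst (l : C) : clim (fun=> l) l.
Proof. by move=> e e0; exists 0%N => n _; rewrite subrr cmod0 ltW. Qed.

Lemma clim_add u u' (l l' : C) : clim u l -> clim u' l' ->
  clim (fun n => u n + u' n) (l + l').
Proof.
move=> h h' e e0; have e2 : 0 < e / 2 by lra.
have [N hN] := h _ e2; have [N' hN'] := h' _ e2.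
exists (maxn N N') => n; rewrite geq_max => /andP[/hN h1 /hN' h2].
have -> : u n + u' n - (l + l') = (u n - l) + (u' n - l') by ring.
have -> : e = e / 2 + e / 2 by field.
exact: cmod_leD.
Qed.

Lemma clim_mul u (a l : C) : clim u l -> clim (fun n => a * u n) (a * l).
Proof.
move=> h e e0; have a0 : 0 < cmod a + 1 by have := cmod_ge0 a; lra.
have [N hN] := h _ (divr_gt0 e0 a0); exists N => n /hN hn.
rewrite -mulrBr cmodM; have := cmod_ge0 a; have := cmod_ge0 (u n - l).
move: hn; rewrite ler_pdivlMr// => *; nra.
Qed.

Lemma clim_sub u u' (l l' : C) : clim u l -> clim u' l' ->
  clim (fun n => u n - u' n) (l - l').
Proof.
move=> h /(clim_mul (-1)); rewrite mulN1r => h'.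
under eq_fun do rewrite -[X in _ - X]mul1r -mulNr.
exact: clim_add.
Qed.

Lemma clim_sum (I : Type) (r : seq I) (P : pred I) (v : I -> nat -> C) (l : I -> C) :
  (forall i, P i -> clim (v i) (l i)) ->
  clim (fun n => \sum_(i <- r | P i) v i n) (\sum_(i <- r | P i) l i).
Proof.
move=> h; elim: r => [|i r IH].
  by rewrite big_nil; under eq_fun do rewrite big_nil; exact: clim_cst.
rewrite big_cons; under eq_fun do rewrite big_cons.
by case: ifP => // /h hi; exact: clim_add.
Qed.

Lemma clim_le u (l : C) (b : R) N :
  (forall n, (N <= n)%N -> cmod (u n) <= b) -> clim u l -> cmod l <= b.
Proof.
move=> hb h; apply/ler_addgt0Pr => e e0; have [N' hN] := h _ e0.
have h1 := hN _ (leq_maxr N N'); have h2 := hb _ (leq_maxl N N').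
have -> : l = u (maxn N N') - (u (maxn N N') - l) by ring.
exact: cmod_leB.
Qed.

Lemma real_cauchy (x : nat -> R) :
  (forall e : R, 0 < e -> exists N, forall n, (N <= n)%N -> `|x n - x N| <= e) ->
  exists l, forall e : R, 0 < e -> exists N, forall n, (N <= n)%N -> `|x n - l| <= e.
Proof.
move=> h; have /R_complete hc : cauchy (x @ \oo).
  apply/cauchyP => e e0; have [N hN] := h (e / 2) ltac:(lra).
  exists (x N), N => // n /= /hN hn; rewrite /ball /= distrC.
  by apply: le_lt_trans hn _; lra.
exists (lim (x @ \oo)) => e e0.
move/cvgrPdist_le : hc => /(_ e e0) [N _ hN].
by exists N => n hn; rewrite distrC; exact: hN.
Qed.

Lemma clim_cauchy u :
  (forall e : R, 0 < e -> exists N, forall n m, (N <= n)%N -> (N <= m)%N ->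
     cmod (u n - u m) <= e) ->
  exists l, clim u l.
Proof.
move=> h.
have [|a ha] := @real_cauchy (fun n => complex.Re (u n)).
  move=> e /h [N hN]; exists N => n /hN /(_ (leqnn N)); apply: le_trans.
  by apply: le_trans (Re_le_cmod _); case: (u n) => ? ?; case: (u N).
have [|b hb] := @real_cauchy (fun n => complex.Im (u n)).
  move=> e /h [N hN]; exists N => n /hN /(_ (leqnn N)); apply: le_trans.
  by apply: le_trans (Im_le_cmod _); case: (u n) => ? ?; case: (u N).
exists (a%:K + 'i%C * b%:K) => e e0; have e2 : 0 < e / 2 by lra.
have [N hN] := ha _ e2; have [N' hN'] := hb _ e2.
exists (maxn N N') => n; rewrite geq_max => /andP[/hN h1 /hN' h2].
have -> : u n - (a%:K + 'i%C * b%:K) =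
    (complex.Re (u n) - a)%:K + 'i%C * (complex.Im (u n) - b)%:K.
  by rewrite {1}(complexE (u n)) !rmorphB /=; ring.
have -> : e = e / 2 + e / 2 by field.
apply: cmod_leD; first by rewrite cmodR.
by rewrite cmodM cmod_i mul1r cmodR.
Qed.

(* The mean of [g] over the midpoints of the [2^n] dyadic subintervals of
   [0, 1].  It serves as the integral over [0, 1]: it is exact on affine
   functions, and cutting the interval in two only shifts [n]. *)
Fixpoint mmean n g : C :=
  if n is m.+1 then
    (mmean m (fun t => g (t / 2)) + mmean m (fun t => g ((1 + t) / 2))) / 2
  else g 2^-1.

Lemma eq_mmean n g k :
  (forall t, 0 <= t <= 1 -> g t = k t) -> mmean n g = mmean n k.
Proof.
elim: n g k => [|n IH] g k h /=; first by apply: h; lra.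
by congr ((_ + _) / 2); apply: IH => t ht; apply: h; lra.
Qed.

Lemma mmeanD n g k : mmean n (fun t => g t + k t) = mmean n g + mmean n k.
Proof. by elim: n g k => [//|n IH] g k /=; rewrite !IH; field. Qed.

Lemma mmeanZ n (a : C) g : mmean n (fun t => a * g t) = a * mmean n g.
Proof. by elim: n g => [//|n IH] g /=; rewrite !IH; field. Qed.

Lemma mmeanN n g : mmean n (fun t => - g t) = - mmean n g.
Proof. by elim: n g => [//|n IH] g /=; rewrite !IH; field. Qed.

Lemma mmeanB n g k : mmean n (fun t => g t - k t) = mmean n g - mmean n k.
Proof. by rewrite mmeanD mmeanN. Qed.

Lemma mmean_sum n (I : Type) (r : seq I) (P : pred I) (F : I -> R -> C) :
  mmean n (fun t => \sum_(i <- r | P i) F i t) = \sum_(i <- r | P i) mmean n (F i).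
Proof.
elim: r => [|i r IH].
  rewrite big_nil; under eq_mmean => t _ do rewrite big_nil -(mul0r 0).
  by rewrite (mmeanZ n 0 (fun=> 0)) mul0r.
rewrite big_cons -IH; under eq_mmean => t _ do rewrite big_cons.
by case: (P i) => //; rewrite mmeanD.
Qed.

Lemma mmean_affine n (a b : C) : mmean n (fun t => a + b * t%:K) = a + b / 2.
Proof.
elim: n a b => [|n IH] a b /=; first by rewrite fmorphV rmorph_nat.
have two : (2^-1 : R)%:K = 2^-1 by rewrite fmorphV rmorph_nat.
rewrite (eq_mmean n (k := fun t => a + b / 2 * t%:K)); last first.
  by move=> t _; rewrite rmorphM /= two; ring.
rewrite IH (eq_mmean n (k := fun t => (a + b / 2) + b / 2 * t%:K)).
  by rewrite IH; field.
by move=> t _; rewrite rmorphM rmorphD /= rmorph1 two; ring.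
Qed.

Lemma mmean_cst n (a : C) : mmean n (fun=> a) = a.
Proof.
rewrite -[RHS]addr0 -[in RHS](mul0r 2^-1) -(mmean_affine n a 0).
by apply: eq_mmean => t _; rewrite mul0r addr0.
Qed.

Lemma mmean_le n g (M : R) :
  (forall t, 0 <= t <= 1 -> cmod (g t) <= M) -> cmod (mmean n g) <= M.
Proof.
elim: n g => [|n IH] g h /=; first by apply: h; lra.
have h1 : cmod (mmean n (fun t => g (t / 2))) <= M by apply: IH => t ht; apply: h; lra.
have h2 : cmod (mmean n (fun t => g ((1 + t) / 2))) <= M.
  by apply: IH => t ht; apply: h; lra.
rewrite cmodM cmodV cmod_nat ler_pdivrMr//.
by apply: le_trans (cmod_leD h1 h2) _; lra.
Qed.

(** Serves to keep the contour means of [1/z] away from 0. *)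
Lemma mmean_Im_ge n g (m : R) :
  (forall t, 0 <= t <= 1 -> m <= complex.Im (g t)) -> m <= complex.Im (mmean n g).
Proof.
elim: n g => [|n IH] g h /=; first by apply: h; lra.
have h1 : m <= complex.Im (mmean n (fun t => g (t / 2))) by apply: IH => t ht; apply: h; lra.
have h2 : m <= complex.Im (mmean n (fun t => g ((1 + t) / 2))).
  by apply: IH => t ht; apply: h; lra.
have i2 (z : C) : complex.Im (z / 2) = complex.Im z / 2.
  have -> : (2 : C)^-1 = (2^-1)%:K by rewrite fmorphV rmorph_nat.
  by case: z => x y /=; rewrite mulr0 add0r mulrC.
have iD (z w : C) : complex.Im (z + w) = complex.Im z + complex.Im w.
  by case: z; case: w.
by rewrite i2 iD; lra.
Qed.

Definition cont01 g :=
  forall p : R, 0 <= p <= 1 -> forall e : R, 0 < e -> exists2 d : R, 0 < d &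
    forall t, 0 <= t <= 1 -> `|t - p| < d -> cmod (g t - g p) <= e.

Lemma cont01_bounded g : cont01 g ->
  exists M : R, forall t, 0 <= t <= 1 -> cmod (g t) <= M.
Proof.
move=> hg.
suff : exists M, forall t, 0 <= t <= 0 + (2^-1 ^+ 0 : R) -> cmod (g t) <= M.
  by move=> [M hM]; exists M => t ht; apply: hM; rewrite expr0; lra.
apply: (@bisection1 _ (fun n x => exists M, forall t, x <= t <= x + 2^-1 ^+ n ->
  cmod (g t) <= M)).
- move=> n x [M hM] [M' hM']; exists (Num.max M M') => t ht.
  rewrite le_max; have [h|h] := leP t (x + 2^-1 ^+ n.+1).
    by rewrite hM//; move: ht h; lra.
  rewrite [X in _ || X]hM' ?orbT//; move: ht h; rewrite {1}exprS exprS; lra.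
- move=> p hp; have [d d0 hd] := hg p hp 1 ltr01.
  have [n hn] := small_pow2 d0; exists n => x /= x0 x1 hpx.
  exists (1 + cmod (g p)) => t ht.
  have -> : g t = (g t - g p) + g p by ring.
  apply: cmod_leD => //; apply: hd; first lra.
  by apply: le_lt_trans hn; rewrite ler_norml; lra.
Qed.

(** Bisection replaces uniform continuity. Where [g] stays within [e / 2] of a value, any two means
    differ by at most [e]; averaging the two halves of an interval preserves this Cauchy bound and
    raises the threshold by one level. *)
Lemma mmean_cvg g : cont01 g -> exists l, clim (fun n => mmean n g) l.
Proof.
move=> hg; apply: clim_cauchy => e e0.
pose P (k : nat) (x : R) := exists N, forall n m, (N <= n)%N -> (N <= m)%N ->
  cmod (mmean n (fun t => g (x + t * 2^-1 ^+ k)) -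
        mmean m (fun t => g (x + t * 2^-1 ^+ k))) <= e.
suff : P 0%N 0.
  rewrite /P; suff -> : (fun t : R => g (0 + t * 2^-1 ^+ 0)) = g by [].
  by apply/funext => t; rewrite expr0 mulr1 add0r.
apply: bisection1.
- move=> k x [N1 h1] [N2 h2]; exists (maxn N1 N2).+1 => -[//|n] [//|m].
  rewrite !ltnS !geq_max => /andP[n1 n2] /andP[m1 m2] /=.
  have El j : mmean j (fun t => g (x + t / 2 * 2^-1 ^+ k)) =
              mmean j (fun t => g (x + t * 2^-1 ^+ k.+1)).
    by apply: eq_mmean => t _; rewrite exprS mulrA.
  have Er j : mmean j (fun t => g (x + (1 + t) / 2 * 2^-1 ^+ k)) =
              mmean j (fun t => g (x + 2^-1 ^+ k.+1 + t * 2^-1 ^+ k.+1)).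
    by apply: eq_mmean => t _; congr g; rewrite exprS; ring.
  rewrite !El !Er -mulrBl opprD addrACA cmodM cmodV cmod_nat ler_pdivrMr//.
  by apply: le_trans (cmod_leD (h1 _ _ n1 m1) (h2 _ _ n2 m2)) _; lra.
- move=> p hp; have e2 : 0 < e / 2 by lra.
  have [d d0 hd] := hg p hp _ e2.
  have [k hk] := small_pow2 d0; exists k => x /= x0 x1 hpx; exists 0%N => n m _ _.
  have k0 : 0 <= 2^-1 ^+ k :> R by apply: exprn_ge0; lra.
  have hs j : cmod (mmean j (fun t => g (x + t * 2^-1 ^+ k)) - g p) <= e / 2.
    rewrite -(mmean_cst j (g p)) -mmeanB; apply: mmean_le => t ht.
    have h1 : 0 <= t * 2^-1 ^+ k by nra.
    have h2 : t * 2^-1 ^+ k <= 2^-1 ^+ k by nra.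
    apply: hd; first lra.
    by apply: le_lt_trans hk; rewrite ler_norml; lra.
  set a := mmean n _ in hs *; set b := mmean m _.
  have -> : a - b = (a - g p) - (b - g p) by ring.
  have -> : e = e / 2 + e / 2 by field.
  by apply: cmod_leB; exact: hs.
Qed.

End MidpointMeans.

(** * Complex derivatives in epsilon-delta form *)

Section ComplexDerivative.
Variable R : realType.
Local Notation C := (Cplx R).

(* Arithmetic on [R[i]^o] and on [R[i]] is convertible but not syntactically
   equal; [cderiv] and [cdiff] keep all terms over [R[i]]. *)
Definition cderiv (f : R[i] -> R[i]) (p d : R[i]) := forall e : R, 0 < e -> exists2 r : R, 0 < r &
  forall z : R[i], cmod (z - p) < r ->
    cmod (f z - f p - d * (z - p)) <= e * cmod (z - p).

Lemma cderivP (f : R[i] -> R[i]) (p d : R[i]) :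
  @is_derive R[i] C C p 1 f d <-> cderiv f p d.
Proof.
pose q (t : C) : C := t^-1 *: (((f : C -> C) \o shift (p : C)) (t *: 1) - (f p : C)).
have qE (t : R[i]) : q t = (f (t + p) - f p) / t.
  by rewrite /q /= [t%:A]mulr1 [RHS]mulrC.
have key : (q t @[t --> (0 : C)^'] --> (d : C)) <-> cderiv f p d.
  split.
  - move=> /cvgrPdist_le hq e e0.
    have /hq/near0_cmodP[r r0 hr] : (0 : R[i]) < e%:C%C by rewrite ltcR.
    exists r => // z hz; have [->|zp] := eqVneq z p.
      by rewrite !subrr mulr0 subr0 cmod0 mulr0.
    have zp0 : z - p != 0 by rewrite subr_eq0.
    have := hr _ zp0 hz; rewrite qE subrK norm_cmod lecR.
    rewrite (cmodC d ((f z - f p) / (z - p))) => h1.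
    have -> : f z - f p - d * (z - p) = ((f z - f p) / (z - p) - d) * (z - p).
      by rewrite mulrBl divfK.
    by rewrite cmodM ler_wpM2r// cmod_ge0.
  - move=> hd; apply/cvgrPdist_le => e e0.
    have eE : e = (complex.Re e)%:C%C by rewrite RRe_real// ger0_real// ltW.
    have e0' : 0 < complex.Re e by move: e0; rewrite {1}eE ltcR.
    have [r r0 hr] := hd _ e0'; apply/near0_cmodP; exists r => // t t0 ht.
    rewrite eE norm_cmod lecR cmodC qE.
    have := hr (t + p); rewrite addrK => /(_ ht).
    rewrite -ler_pdivrMr ?cmod_gt0// -cmodV -cmodM; apply: le_trans.
    by rewrite [X in _ <= cmod X]mulrBl mulfK.
split.
- move=> [h1 h2]; apply/key; rewrite -h2; exact: h1.
- move=> /key h; split; first by apply/cvg_ex; exists d.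
  exact: cvg_lim h.
Qed.

Definition cdiff (f : R[i] -> R[i]) (p : R[i]) := @derivable R[i] C C f p 1.

Lemma cdiffP (f : R[i] -> R[i]) (p : R[i]) : cdiff f p <-> exists d, cderiv f p d.
Proof.
split=> [h|[d /cderivP []//]].
by exists (@derive R[i] C C f p 1); apply/cderivP; split.
Qed.

Lemma cderiv_derive1 (f : R[i] -> R[i]) (p d : R[i]) :
  cderiv f p d -> derive1 (f : C -> C) p = d.
Proof. by move=> /cderivP [_ <-]; rewrite derive1E. Qed.

End ComplexDerivative.

Section ComplexDerivativeTheory.
Variable R : realType.
Implicit Types (f h : R[i] -> R[i]) (p d z : R[i]).

Lemma cderiv_near f h p d (r : R) : 0 < r ->
  (forall z, cmod (z - p) < r -> f z = h z) -> cderiv f p d -> cderiv h p d.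
Proof.
move=> r0 hr hd e /hd [r' r'0 hr']; exists (Num.min r r').
  by rewrite lt_min r0.
move=> z; rewrite lt_min => /andP[h1 h2]; rewrite -!hr ?subrr ?cmod0//.
exact: hr'.
Qed.

Lemma cderiv_continuous f p d : cderiv f p d ->
  forall e : R, 0 < e -> exists2 r : R, 0 < r &
    forall z, cmod (z - p) < r -> cmod (f z - f p) <= e.
Proof.
move=> hd e e0; have [r r0 hr] := hd _ ltr01.
have d0 : 0 < cmod d + 1 by have := cmod_ge0 d; lra.
exists (Num.min r (e / (cmod d + 1))); first by rewrite lt_min r0 divr_gt0.
move=> z; rewrite lt_min => /andP[/hr h1]; rewrite ltr_pdivlMr// => h2.
have -> : f z - f p = (f z - f p - d * (z - p)) + d * (z - p) by ring.
apply: le_trans (cmodD _ _) _; rewrite cmodM; lra.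
Qed.

End ComplexDerivativeTheory.

(** * Means around quadrilaterals and Goursat's theorem *)

Section Goursat.
Variable R : realType.
Local Notation C := R[i].
Local Notation "x %:K" := (x%:C%C : C) (at level 1, format "x %:K").
Implicit Types (f h : C -> C) (a b p d z : C).

Definition seg_mean n h a b : C :=
  (b - a) * mmean n (fun t => h (a + t%:K * (b - a))).

Lemma seg_mean_mid n h a b m : m = (a + b) / 2 ->
  seg_mean n.+1 h a b = seg_mean n h a m + seg_mean n h m b.
Proof.
move=> ->; rewrite /seg_mean /=.
have two : (2^-1 : R)%:K = 2^-1 by rewrite fmorphV rmorph_nat.
set s1 := mmean n _; set s2 := mmean n _; set t1 := mmean n _; set t2 := mmean n _.
have -> : s1 = t1.
  by apply: eq_mmean => t _; congr h; rewrite rmorphM /= two; field.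
have -> : s2 = t2.
  by apply: eq_mmean => t _; congr h; rewrite rmorphM rmorphD /= rmorph1 two; field.
by field.
Qed.

Lemma seg_mean_le n h a b (M : R) :
  (forall t : R, 0 <= t <= 1 -> cmod (h (a + t%:K * (b - a))) <= M) ->
  cmod (seg_mean n h a b) <= cmod (b - a) * M.
Proof.
by move=> hM; rewrite cmodM ler_wpM2l ?cmod_ge0//; exact: mmean_le.
Qed.

Lemma seg_meanD n f h a b :
  seg_mean n (fun z => f z + h z) a b = seg_mean n f a b + seg_mean n h a b.
Proof. by rewrite /seg_mean mmeanD mulrDr. Qed.

Lemma seg_mean_affine n (c d : C) a b :
  seg_mean n (fun z => c + d * z) a b = (b - a) * (c + d * (a + b) / 2).
Proof.
rewrite /seg_mean (eq_mmean n (k := fun t => (c + d * a) + d * (b - a) * t%:K)).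
  by rewrite mmean_affine; field.
by move=> t _; ring.
Qed.

Variables A B D E : C.

(** Affine in each variable separately, so horizontal and vertical segments have straight images
    whose midpoints are the images of midpoints; the [E] term allows quadrilaterals other than
    parallelograms. *)
Definition bilin (x y : R) : C := A + x%:K * B + y%:K * D + (x * y)%:K * E.

(* Edges are traversed in the direction of increasing coordinates, hence the
   signs of the last two. *)
Definition quad_mean n h (x y l : R) : C :=
  seg_mean n h (bilin x y) (bilin (x + l) y) +
  seg_mean n h (bilin (x + l) y) (bilin (x + l) (y + l)) -
  seg_mean n h (bilin x (y + l)) (bilin (x + l) (y + l)) -
  seg_mean n h (bilin x y) (bilin x (y + l)).

(** Each outer edge is cut at its midpoint at the cost of one level of the mean, and each inner edge
    is traversed twice with opposite signs. *)
Lemma quad_mean_split n h (x y l l' : R) : l = l' + l' ->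
  quad_mean n.+1 h x y l =
  quad_mean n h x y l' + quad_mean n h (x + l') y l' +
  quad_mean n h x (y + l') l' + quad_mean n h (x + l') (y + l') l'.
Proof.
move=> ->; rewrite /quad_mean.
have two : 2 != 0 :> C by rewrite pnatr_eq0.
rewrite (@seg_mean_mid n h (bilin x y) (bilin (x + (l' + l')) y) (bilin (x + l') y));
  last by rewrite /bilin !rmorphM !rmorphD /=; field.
rewrite (@seg_mean_mid n h (bilin (x + (l' + l')) y) (bilin (x + (l' + l')) (y + (l' + l')))
  (bilin (x + (l' + l')) (y + l')));
  last by rewrite /bilin !rmorphM !rmorphD /=; field.
rewrite (@seg_mean_mid n h (bilin x (y + (l' + l'))) (bilin (x + (l' + l')) (y + (l' + l')))
  (bilin (x + l') (y + (l' + l'))));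
  last by rewrite /bilin !rmorphM !rmorphD /=; field.
rewrite (@seg_mean_mid n h (bilin x y) (bilin x (y + (l' + l'))) (bilin x (y + l')));
  last by rewrite /bilin !rmorphM !rmorphD /=; field.
rewrite !addrA; ring.
Qed.

(** The factor 2 at [cmod E] comes from [x'y' - xy = (x' - x)y' + x(y' - y)] with [x] and [y'] in
    the unit interval. *)
Lemma bilin_dist (x y x' y' l : R) :
  0 <= x <= 1 -> 0 <= y' <= 1 -> `|x' - x| <= l -> `|y' - y| <= l ->
  cmod (bilin x' y' - bilin x y) <= (cmod B + cmod D + 2 * cmod E) * l.
Proof.
move=> hx hy hxl hyl.
have -> : bilin x' y' - bilin x y =
    ((x' - x)%:K * B + (y' - y)%:K * D) + ((x' - x) * y' + x * (y' - y))%:K * E.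
  by rewrite /bilin rmorphD !rmorphM /= !rmorphB /=; ring.
have l0 : 0 <= l by apply: le_trans hxl.
have -> : (cmod B + cmod D + 2 * cmod E) * l =
    cmod B * l + cmod D * l + cmod E * (2 * l) by ring.
apply: cmod_leD; first apply: cmod_leD.
- by rewrite cmodM cmodR mulrC ler_wpM2l ?cmod_ge0.
- by rewrite cmodM cmodR mulrC ler_wpM2l ?cmod_ge0.
rewrite cmodM cmodR mulrC ler_wpM2l ?cmod_ge0//.
apply: le_trans (ler_normD _ _) _; rewrite !normrM (ger0_norm (x := y')); last by case/andP: hy.
rewrite (ger0_norm (x := x)); last by case/andP: hx.
have := normr_ge0 (x' - x); have := normr_ge0 (y' - y); nra.
Qed.

(** Means are exact on affine functions, so the first order part of [h] at [p] contributes exactly 0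
    around the closed quadrilateral. The remainder is at most [e * (K * l)] on four edges, each of
    length at most [2 * (K * l)]. *)
Lemma quad_mean_local n h p d (x y l K e : R) :
  0 <= l ->
  (forall x' y', x <= x' <= x + l -> y <= y' <= y + l ->
     cmod (bilin x' y' - p) <= K * l) ->
  (forall z, cmod (z - p) <= K * l ->
     cmod (h z - h p - d * (z - p)) <= e * (K * l)) -> 0 <= K * l ->
  cmod (quad_mean n h x y l) <= 8 * e * (K * l) ^+ 2.
Proof.
move=> l0 hK hd Kl0.
pose r z := h z - h p - d * (z - p).
have hE : h = (fun z => (h p - d * p + d * z) + r z).
  by apply/funext => z; rewrite /r; ring.
have -> : quad_mean n h x y l = quad_mean n r x y l.
  have segE a b : seg_mean n h a b =
      (b - a) * (h p - d * p + d * (a + b) / 2) + seg_mean n r a b.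
    by rewrite {1}hE seg_meanD seg_mean_affine.
  by rewrite /quad_mean !segE; field.
have seg a b : cmod (a - p) <= K * l -> cmod (b - p) <= K * l ->
    cmod (seg_mean n r a b) <= 2 * e * (K * l) ^+ 2.
  move=> ha hb.
  have ab : cmod (b - a) <= K * l + K * l.
    by have -> : b - a = (b - p) - (a - p) by [ring]; exact: cmod_leB.
  have -> : 2 * e * (K * l) ^+ 2 = (K * l + K * l) * (e * (K * l)) by ring.
  have e0 : 0 <= e * (K * l).
    by apply: le_trans (cmod_ge0 _) (hd p _); rewrite subrr cmod0.
  apply: le_trans (seg_mean_le (M := e * (K * l)) _ _) _; last by rewrite ler_wpM2r.
  move=> t /andP[t0 t1]; apply: hd.
  have -> : a + t%:K * (b - a) - p = (1 - t)%:K * (a - p) + t%:K * (b - p).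
    by rewrite rmorphB /= rmorph1; ring.
  have -> : K * l = (1 - t) * (K * l) + t * (K * l) by ring.
  by apply: cmod_leD; rewrite cmodM cmodR ger0_norm ?subr_ge0// ler_wpM2l// subr_ge0.
have -> : 8 * e * (K * l) ^+ 2 = 2 * e * (K * l) ^+ 2 + 2 * e * (K * l) ^+ 2 +
   2 * e * (K * l) ^+ 2 + 2 * e * (K * l) ^+ 2 by ring.
apply: cmod_leB; first apply: cmod_leB; first apply: cmod_leD.
all: by apply: seg; apply: hK; lra.
Qed.

(** The bound [c * 4^-1 ^+ k] scales like the area of a subsquare, so four quarters pass it on to
    their union without loss, while differentiability at a point gives it on all small squares
    around that point. *)
Theorem goursat h :
  (forall x y : R, 0 <= x <= 1 -> 0 <= y <= 1 -> cdiff h (bilin x y)) ->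
  clim (fun n => quad_mean n h 0 0 1) 0.
Proof.
move=> hd c c0.
pose P (k : nat) (x y : R) := exists N, forall n, (N <= n)%N ->
  cmod (quad_mean n h x y (2^-1 ^+ k)) <= c * (4^-1 ^+ k).
suff [N hN] : P 0%N 0 0.
  by exists N => n /hN; rewrite !expr0 mulr1 subr0.
apply: bisection2.
- move=> k x y l [N1 h1] [N2 h2] [N3 h3] [N4 h4].
  exists (maxn (maxn N1 N2) (maxn N3 N4)).+1 => -[//|n].
  rewrite ltnS !geq_max => /andP[/andP[n1 n2] /andP[n3 n4]].
  rewrite (@quad_mean_split n h x y _ l); last by rewrite /l exprS; field.
  have -> : c * 4^-1 ^+ k = c * 4^-1 ^+ k.+1 + c * 4^-1 ^+ k.+1 +
    c * 4^-1 ^+ k.+1 + c * 4^-1 ^+ k.+1 by rewrite exprS; field.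
  by apply: cmod_leD (h4 _ n4); apply: cmod_leD (h3 _ n3);
    apply: cmod_leD (h2 _ n2); exact: h1.
- move=> px py hpx hpy.
  have [d hd'] := (cdiffP _ _).1 (hd _ _ hpx hpy).
  pose K := cmod B + cmod D + 2 * cmod E + 1.
  have K0 : 0 < K.
    by have := cmod_ge0 B; have := cmod_ge0 D; have := cmod_ge0 E; rewrite /K; lra.
  (* With this tolerance the bound of [quad_mean_local] becomes [c * l ^+ 2], which is
     [c * 4^-1 ^+ k]. *)
  have e0 : 0 < c / (8 * K ^+ 2) by rewrite divr_gt0// mulr_gt0// exprn_gt0.
  have [r r0 hr] := hd' _ e0.
  have [k hk] := small_pow2 (divr_gt0 r0 K0); exists k => x y /= x0 x1 y0 y1 hx hy.
  set l := 2^-1 ^+ k in hk x1 y1 hx hy *.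
  have l0 : 0 <= l by apply: exprn_ge0; lra.
  exists 0%N => n _.
  have -> : c * 4^-1 ^+ k = 8 * (c / (8 * K ^+ 2)) * (K * l) ^+ 2.
    have -> : 4^-1 ^+ k = l ^+ 2 by rewrite -exprM mulnC exprM; congr (_ ^+ _); field.
    by field; rewrite gt_eqF.
  apply: (@quad_mean_local n h (bilin px py) d x y l K) => //.
  + move=> x' y' hx' hy'; apply: le_trans (_ : _ <= (K - 1) * l) _; last nra.
    by rewrite /K addrK; apply: bilin_dist => //; rewrite ?ler_norml; lra.
  + move=> z hz; apply: le_trans (hr z _) _; last by rewrite ler_wpM2l// ltW.
    by apply: le_lt_trans hz _; rewrite mulrC -ltr_pdivlMr.
  + by rewrite mulr_ge0// ltW.
Qed.

End Goursat.

(** * Cauchy's formula on a square *)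

Section DerivableOperations.
Variable R : realType.
Implicit Types (f g : R[i] -> R[i]) (p w : R[i]).

Lemma cdiffM f g p : cdiff f p -> cdiff g p -> cdiff (fun z => f z * g z) p.
Proof. exact: derivableM. Qed.

Lemma cdiffD f g p : cdiff f p -> cdiff g p -> cdiff (fun z => f z + g z) p.
Proof. exact: derivableD. Qed.

Lemma cdiffB f g p : cdiff f p -> cdiff g p -> cdiff (fun z => f z - g z) p.
Proof. exact: derivableB. Qed.

Lemma cdiff_cst (a : R[i]) p : cdiff (fun=> a) p.
Proof. exact: derivable_cst. Qed.

Lemma cdiff_id p : cdiff id p.
Proof. exact: derivable_id. Qed.

Lemma cdiffZ (a : R[i]) f p : cdiff f p -> cdiff (fun z => a * f z) p.
Proof. by move=> h; apply: cdiffM h; exact: cdiff_cst. Qed.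

Lemma cdiff_inv_sub w p : p - w != 0 -> cdiff (fun z => (z - w)^-1) p.
Proof.
by move=> pw; apply: (@derivableV R[i] (Cplx R) (fun z => z - w)).
Qed.

Lemma cdiffX f p n : cdiff f p -> cdiff (fun z => f z ^+ n) p.
Proof.
move=> hf; elim: n => [|n IH].
  rewrite (_ : (fun z => _) = (fun=> 1)); first exact: cdiff_cst.
  by apply/funext => z; rewrite expr0.
rewrite (_ : (fun z => _) = (fun z => f z * f z ^+ n)); first exact: cdiffM.
by apply/funext => z; rewrite exprS.
Qed.

Lemma cdiff_inv p : p != 0 -> cdiff (fun z => z^-1) p.
Proof.
move=> p0; rewrite (_ : (fun z => z^-1) = (fun z => (z - 0)^-1)).
  by apply: cdiff_inv_sub; rewrite subr0.
by apply/funext => z; rewrite subr0.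
Qed.

End DerivableOperations.

Section CauchyFormula.
Variable R : realType.
Local Notation C := R[i].
Local Notation "x %:K" := (x%:C%C : C) (at level 1, format "x %:K").
Variable s : R.
Hypothesis s0 : 0 < s.
Implicit Types (f phi : C -> C) (z w : C) (t : R).

(** The square stands on a corner: multiplication by [i] permutes its edges, so one computation
    serves all four. *)
Definition vertex (j : nat) : C := s%:K * 'i%C ^+ j.
Definition side (j : nat) : C := vertex j.+1 - vertex j.
Definition edge (j : nat) t : C := vertex j + t%:K * side j.
Definition on_square z := exists (j : 'I_4) t, 0 <= t <= 1 /\ z = edge j t.

Lemma vertex4 : vertex 4 = vertex 0.
Proof. by rewrite /vertex (exprM _ 2 2) sqr_i sqrrN expr1n expr0. Qed.

Lemma edgeE j t : edge j t = vertex j * ((1 - t)%:K + t%:K * 'i%C).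
Proof. by rewrite /edge /side /vertex exprSr rmorphB /= rmorph1; ring. Qed.

Lemma cmod_vertex j : cmod (vertex j) = s.
Proof. by rewrite cmodM cmodX cmod_i expr1n mulr1 cmodR ger0_norm// ltW. Qed.

Lemma cmod_side j : cmod (side j) <= 2 * s.
Proof.
have -> : 2 * s = s + s by ring.
by apply: cmod_leB; rewrite cmod_vertex.
Qed.

(** The modulus of [(1 - t) + t i] is at least both [1 - t] and [t], one of which is at least [1/2].
    This rational bound replaces the sharp [s / sqrt 2]. *)
Lemma on_square_bounds z : on_square z -> s / 2 <= cmod z <= s.
Proof.
move=> [j [t [t01 ->]]]; rewrite edgeE cmodM cmod_vertex.
set y := (1 - t)%:K + _.
have hy : y = ((1 - t) +i* t)%C.
  by rewrite [RHS]complexE /y [t%:K * _]mulrC.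
have h1 : `|1 - t| <= cmod y by rewrite hy; exact: (Re_le_cmod ((1 - t) +i* t)%C).
have h2 : `|t| <= cmod y by rewrite hy; exact: (Im_le_cmod ((1 - t) +i* t)%C).
rewrite ger0_norm in h1; last by lra.
rewrite ger0_norm in h2; last by lra.
have h3 : cmod y <= 1.
  apply: (@le_trans _ _ ((1 - t) + t)); last by rewrite subrK.
  apply: cmod_leD; rewrite ?cmodM ?cmod_i ?mulr1 cmodR ger0_norm//; lra.
have h4 : 2^-1 <= cmod y by lra.
by rewrite ler_pM2l// h4 ler_piMr// ltW.
Qed.

(** The radius [s / 4] is half the lower bound [s / 2] on the contour, which leaves a distance of at
    least [s / 4]. *)
Lemma on_square_sub_neq0 z w : on_square z -> cmod w <= s / 4 ->
  z - w != 0 /\ cmod (z - w)^-1 <= 4 / s.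
Proof.
have s_gt0 := s0; move=> /on_square_bounds zs ws; have h := cmod_geB z w.
have h4 : s / 4 <= cmod (z - w) by lra.
split; first by rewrite -cmod_gt0; lra.
by rewrite cmodV -[4 / s]invf_div lef_pV2// posrE; lra.
Qed.

(** All four edges share the parameter [t], so that a contour integral is a single mean over the
    unit interval. *)
Definition square_term phi t : C := \sum_(j < 4) side j * phi (edge j t).
Definition square_mean n phi : C := mmean n (square_term phi).
Definition square_integral phi : C := xget 0 [set l | clim (fun n => square_mean n phi) l].

Lemma square_meanE n phi :
  square_mean n phi = \sum_(j < 4) seg_mean n phi (vertex j) (vertex j.+1).
Proof.
rewrite /square_mean /square_term mmean_sum; apply: eq_bigr => j _.
exact: mmeanZ.
Qed.

Lemma square_mean_le n phi (M : R) :
  (forall z, on_square z -> cmod (phi z) <= M) ->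
  cmod (square_mean n phi) <= 8 * s * M.
Proof.
move=> h; apply: mmean_le => t t01; apply: le_trans (cmod_sum _ _ _) _.
have -> : 8 * s * M = \sum_(j < 4) (2 * s * M).
  by rewrite sumr_const card_ord -mulr_natl; ring.
apply: ler_sum => j _; rewrite cmodM.
have := cmod_side j; have := cmod_ge0 (side j).
have := cmod_ge0 (phi (edge j t)); have : on_square (edge j t) by exists j, t.
by move=> /h; nra.
Qed.

Lemma eq_square_mean n phi psi : (forall z, on_square z -> phi z = psi z) ->
  square_mean n phi = square_mean n psi.
Proof.
move=> h; apply: eq_mmean => t t01; apply: eq_bigr => j _; congr (_ * _).
by apply: h; exists j, t.
Qed.

Lemma square_meanB n phi psi :
  square_mean n (fun z => phi z - psi z) = square_mean n phi - square_mean n psi.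
Proof.
rewrite /square_mean -mmeanB; apply: eq_mmean => t _.
by rewrite /square_term -sumrB; apply: eq_bigr => j _; rewrite mulrBr.
Qed.

Lemma square_meanZ n a phi :
  square_mean n (fun z => a * phi z) = a * square_mean n phi.
Proof.
rewrite /square_mean -mmeanZ; apply: eq_mmean => t _.
by rewrite /square_term mulr_sumr; apply: eq_bigr => j _; rewrite mulrCA.
Qed.

Lemma edge_cont phi (j : 'I_4) :
  (forall z, on_square z -> cdiff phi z) -> cont01 (fun t => phi (edge j t)).
Proof.
move=> h p p01 e e0.
have jp : on_square (edge j p) by exists j, p.
have [d hd] := (cdiffP _ _).1 (h _ jp).
have [r r0 hr] := cderiv_continuous hd e0.
have s2 : 0 < 2 * s by rewrite mulr_gt0.
exists (r / (2 * s)); first by rewrite divr_gt0.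
move=> t _; rewrite ltr_pdivlMr// => ht; apply: hr.
have -> : edge j t - edge j p = (t - p)%:K * side j by rewrite rmorphB /= /edge; ring.
rewrite cmodM cmodR; apply: le_lt_trans ht.
by rewrite ler_wpM2l// cmod_side.
Qed.

Lemma square_integralP phi : (forall z, on_square z -> cdiff phi z) ->
  clim (fun n => square_mean n phi) (square_integral phi).
Proof.
move=> h; suff [l hl] : exists l, clim (fun n => square_mean n phi) l.
  by rewrite /square_integral; case: xgetP => [_ ->//|/(_ l)].
have [l hl] : exists l : 'I_4 -> C, forall j : 'I_4,
    clim (fun n => mmean n (fun t => phi (edge j t))) (l j).
  exists (fun j => xget 0 [set l | clim (fun n => mmean n (fun t => phi (edge j t))) l]).
  by move=> j; have [l hl] := mmean_cvg (@edge_cont phi j h); exact: xgetI hl.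
exists (\sum_(j < 4) side j * l j).
have E n : square_mean n phi = \sum_(j < 4) side j * mmean n (fun t => phi (edge j t)).
  by rewrite square_meanE; apply: eq_bigr.
rewrite (_ : (fun n => _) = (fun n => \sum_(j < 4) side j * mmean n (fun t => phi (edge j t))));
  last by apply/funext.
by apply: clim_sum => j _; exact: clim_mul.
Qed.

Lemma square_integral_uniq phi (l : C) :
  clim (fun n => square_mean n phi) l -> square_integral phi = l.
Proof.
by move=> h; apply: (clim_uniq _ h); rewrite /square_integral; case: xgetP => [_ ->//|/(_ l)].
Qed.

Lemma eq_square_integral phi psi : (forall z, on_square z -> phi z = psi z) ->
  square_integral phi = square_integral psi.
Proof.
move=> h; rewrite /square_integral; congr (xget 0 _); apply/funext => l.
by under [X in clim X]eq_fun do rewrite (eq_square_mean _ h).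
Qed.

Lemma square_integralB phi psi :
  (forall z, on_square z -> cdiff phi z) -> (forall z, on_square z -> cdiff psi z) ->
  square_integral (fun z => phi z - psi z) = square_integral phi - square_integral psi.
Proof.
move=> h1 h2; apply: square_integral_uniq.
under [X in clim X]eq_fun do rewrite square_meanB.
by apply: clim_sub; exact: square_integralP.
Qed.

Lemma square_integralZ a phi : (forall z, on_square z -> cdiff phi z) ->
  square_integral (fun z => a * phi z) = a * square_integral phi.
Proof.
move=> h1; apply: square_integral_uniq.
under [X in clim X]eq_fun do rewrite square_meanZ.
by apply: clim_mul; exact: square_integralP.
Qed.

Lemma square_integral_le phi (M : R) : (forall z, on_square z -> cdiff phi z) ->
  (forall z, on_square z -> cmod (phi z) <= M) ->
  cmod (square_integral phi) <= 8 * s * M.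
Proof.
move=> h1 h2; apply: (@clim_le _ _ _ _ 0 _ (square_integralP h1)) => n _.
exact: square_mean_le.
Qed.

Lemma on_square_neq0 z : on_square z -> z != 0.
Proof.
have s_gt0 := s0; move=> /on_square_bounds h.
by rewrite -cmod_gt0; lra.
Qed.

(** Classically [2 * pi * i]. *)
Definition winding : C := square_integral (fun z => z^-1).

(** The imaginary part of the integrand, summed over the edges, is [4 / ((1 - t)^2 + t^2)], so every
    mean has imaginary part at least 1 and the limit cannot be 0. *)
Lemma winding_neq0 : winding != 0.
Proof.
have hc : clim (fun n => square_mean n (fun z => z^-1)) winding.
  by apply: square_integralP => z /on_square_neq0; exact: cdiff_inv.
apply/eqP => w0; rewrite w0 in hc.
have [N /(_ N (leqnn N))] := hc 2^-1 ltac:(lra); rewrite subr0.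
apply/negP; rewrite -ltNge; apply: (@lt_le_trans _ _ 1); first lra.
apply: le_trans (Im_le_cmod _); apply: le_trans (ler_norm _).
apply: mmean_Im_ge => t t01.
have s_gt0 := s0.
have sK0 : s%:K != 0 :> C by rewrite fmorph_eq0 gt_eqF.
have i0 : 'i%C != 0 :> C by rewrite -cmod_eq0 cmod_i oner_neq0.
have den : 0 < (1 - t) ^+ 2 + t ^+ 2 by nra.
(* The vertex cancels, leaving [(i - 1) / ((1 - t) + t i)] for every [j]. *)
have E j : side j * (edge j t)^-1 =
    (((1 - t) ^+ 2 + t ^+ 2)^-1)%:K * ((2 * t - 1)%:K + 'i%C).
  rewrite edgeE.
  have n0 : (1 - t)%:K + t%:K * 'i%C != 0 :> C.
    apply/eqP => h; have := congr1 (@complex.Im R) h; have := congr1 (@complex.Re R) h.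
    by rewrite /=; nra.
  rewrite fmorphV; set X := ((1 - t) ^+ 2 + t ^+ 2)%:K.
  have X0 : X != 0 by rewrite fmorph_eq0 gt_eqF.
  have ii : 'i%C * 'i%C = -1 :> C by rewrite -expr2 sqr_i.
  have vj : vertex j != 0 by rewrite mulf_neq0// expf_neq0.
  have -> : side j = vertex j * ('i%C - 1) by rewrite /side /vertex exprSr; ring.
  rewrite invfM mulrACA divff// mul1r.
  apply: (mulIf n0); rewrite divfK//; apply: (mulfI X0); rewrite !mulrA divff// mul1r.
  rewrite /X !rmorphD !rmorphXn !rmorphM !rmorphB /= rmorph1 rmorph_nat.
  set T := t%:K; ring: ii.
have -> : square_term (fun z => z^-1) t =
    4 * (((1 - t) ^+ 2 + t ^+ 2)^-1)%:K * ((2 * t - 1)%:K + 'i%C).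
  rewrite /square_term; under eq_bigr do rewrite E.
  by rewrite sumr_const card_ord; ring.
have -> : 4 * (((1 - t) ^+ 2 + t ^+ 2)^-1)%:K = (4 * ((1 - t) ^+ 2 + t ^+ 2)^-1)%:K :> C.
  by rewrite rmorphM rmorph_nat.
rewrite /= mul0r !add0r addr0 mulr1 ler_pdivlMr//; nra.
Qed.

Section Formula.
Variable f : C -> C.
Hypothesis f_diff : forall z, cmod z <= s -> cdiff f z.

Lemma on_square_kernel w (m n : nat) z : cmod w <= s / 4 -> on_square z ->
  cdiff (fun z => f z * ((z - w)^-1 ^+ m * z^-1 ^+ n)) z.
Proof.
move=> ws zs; have [/andP[_ zs'] [zw _]] := (on_square_bounds zs, on_square_sub_neq0 zs ws).
apply: cdiffM; first exact: f_diff.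
by apply: cdiffM; apply: cdiffX; [exact: cdiff_inv_sub|exact/cdiff_inv/on_square_neq0].
Qed.

Lemma bounded_on_square : exists M : R, 0 <= M /\ forall z, on_square z -> cmod (f z) <= M.
Proof.
have hd z : on_square z -> cdiff f z by move=> /on_square_bounds/andP[_]; exact: f_diff.
pose P (j : 'I_4) M := forall t, 0 <= t <= 1 -> cmod (f (edge j t)) <= M.
have hb (j : 'I_4) : exists M, P j M by exact: cont01_bounded (edge_cont j hd).
pose m (j : 'I_4) : R := xget 0 (P j).
have hm (j : 'I_4) : P j (m j).
  by have [M hM] := hb j; rewrite /m; case: xgetP => [_ ->//|/(_ M)].
have m0 (j : 'I_4) : 0 <= m j by apply: le_trans (cmod_ge0 _) (hm j 0 _); lra.
exists (\sum_(j < 4) m j); split; first exact: sumr_ge0.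
move=> z [j [t [t01 ->]]]; apply: le_trans (hm j t t01) _.
by rewrite (bigD1 j)//= lerDl sumr_ge0.
Qed.

(* The square is deformed through convex quadrilaterals into its small copy
   [w + tau * square], where the difference quotient is controlled by the
   continuity of [f] at [w]. *)
Lemma cauchy_formula w : cmod w <= s / 4 ->
  square_integral (fun z => f z * (z - w)^-1) = f w * winding.
Proof.
move=> ws; have s_gt0 := s0.
pose phi z := f z * (z - w)^-1.
have dphi z : cmod z <= s -> z - w != 0 -> cdiff phi z.
  by move=> zs zw; apply: cdiffM; [exact: f_diff|exact: cdiff_inv_sub].
have dphis z : on_square z -> cdiff phi z.
  move=> zs; apply: dphi; first by case/andP: (on_square_bounds zs).
  by case: (on_square_sub_neq0 zs ws).
apply/eqP; rewrite -subr_eq0 -cmod_eq0; apply/negPn/negP => n0.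
have n0' : 0 < cmod (square_integral phi - f w * winding).
  by rewrite lt_neqAle eq_sym n0 cmod_ge0.
set g := cmod _ in n0'.
have hlim : clim (fun n => square_mean n phi - f w * square_mean n (fun z => z^-1))
    (square_integral phi - f w * winding).
  apply: clim_sub; first exact: square_integralP.
  apply: clim_mul; apply: square_integralP => z /on_square_neq0; exact: cdiff_inv.
(* The contour estimate costs [8 * s] and the kernel [1/z] costs [2 / s]; the tolerance [g / 64]
   then yields [g / 4], too small for the assumed gap [g]. *)
have g64 : 0 < g / 64 by lra.
have [d hd] := (cdiffP _ _).1 (f_diff (z := w) ltac:(lra)).
have [r r0 hr] := cderiv_continuous hd g64.
(* The bound [1/2] keeps the trapezoids in the disc of radius [s] and away from [w]; the other bound
   puts the small copy where [f] is close to [f w]. *)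
pose tau := Num.min 2^-1 (r / (2 * s)).
have tau0 : 0 < tau by rewrite lt_min; apply/andP; split; [lra|rewrite divr_gt0//; lra].
have tau1 : tau <= 2^-1 by rewrite ge_min lexx.
have taur : tau * s < r.
  have : tau <= r / (2 * s) by rewrite ge_min lexx orbT.
  by rewrite ler_pdivlMr; nra.
have tauK0 : tau%:K != 0 :> C by rewrite fmorph_eq0 gt_eqF.
(* As [x] goes from 0 to 1, [sigma j x y] moves from the small copy of the point [edge j y] to that
   point itself. *)
pose sigma (j : nat) := bilin (w + tau%:K * vertex j) ((1 - tau)%:K * vertex j - w)
  (tau%:K * side j) ((1 - tau)%:K * side j).
have sigmaE j x y : sigma j x y =
    w + tau%:K * edge j y + x%:K * ((1 - tau)%:K * edge j y - w).
  by rewrite /sigma /bilin /edge rmorphM /= rmorphB /= rmorph1; ring.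
pose Q n := \sum_(j < 4) quad_mean (w + tau%:K * vertex j) ((1 - tau)%:K * vertex j - w)
  (tau%:K * side j) ((1 - tau)%:K * side j) n phi 0 0 1.
have hQ : clim Q 0.
  suff : clim Q (\sum_(j < 4) 0) by rewrite big1.
  apply: clim_sum => j _; apply: goursat => x y x01 y01.
  rewrite -[bilin _ _ _ _ x y]/(sigma j x y) sigmaE.
  have /on_square_bounds/andP[b1 b2] : on_square (edge j y) by exists j, y.
  set z := edge j y in b1 b2 *.
  apply: dphi.
    have -> : w + tau%:K * z + x%:K * ((1 - tau)%:K * z - w) =
        (1 - x)%:K * (w + tau%:K * z) + x%:K * z.
      by rewrite !rmorphB /= rmorph1; ring.
    have h1 : cmod (w + tau%:K * z) <= s / 4 + tau * s.
      by apply: cmod_leD => //; rewrite cmodM cmodR ger0_norm ?ler_wpM2l// ltW.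
    have -> : s = (1 - x) * s + x * s by ring.
    apply: cmod_leD; rewrite cmodM cmodR ger0_norm; try lra.
      by apply: ler_wpM2l; [lra|nra].
    by apply: ler_wpM2l; lra.
  rewrite -cmod_gt0.
  have -> : w + tau%:K * z + x%:K * ((1 - tau)%:K * z - w) - w =
      (tau + x * (1 - tau))%:K * z - x%:K * w.
    by rewrite !(rmorphD, rmorphM, rmorphN) /= rmorph1; ring.
  apply: lt_le_trans (cmod_geB _ _); rewrite !cmodM !cmodR.
  have k0 : 0 <= tau + x * (1 - tau) by nra.
  rewrite !ger0_norm//; last by case/andP: x01.
  rewrite subr_gt0; apply: (@le_lt_trans _ _ (x * (s / 4))).
    by apply: ler_wpM2l => //; case/andP: x01.
  apply: (@lt_le_trans _ _ ((tau + x * (1 - tau)) * (s / 2))); last exact: ler_wpM2l.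
  have -> : x * (s / 4) = x / 2 * (s / 2) by field.
  rewrite ltr_pM2r; last by rewrite divr_gt0.
  have : 0 <= x * (2^-1 - tau) by apply: mulr_ge0; lra.
  by lra.
have small n : cmod (square_mean n phi - f w * square_mean n (fun z => z^-1) - Q n) <= g / 4.
  (* The edges joining the two squares cancel between neighbouring trapezoids, cyclically thanks to
     [vertex4]. *)
  have -> : Q n = square_mean n phi -
      \sum_(j < 4) seg_mean n phi (w + tau%:K * vertex j) (w + tau%:K * vertex j.+1).
    rewrite square_meanE /Q !big_ord_recr !big_ord0 /=.
    have S j (b := vertex j) (c := vertex j.+1) :
      [/\ sigma j 0 0 = w + tau%:K * b, sigma j 1 0 = b, sigma j 1 1 = c &
          sigma j 0 1 = w + tau%:K * c].
      rewrite !sigmaE /edge /side -/b -/c !rmorphB !rmorph0 !rmorph1 /=.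
      by split; ring.
    have q j : quad_mean (w + tau%:K * vertex j) ((1 - tau)%:K * vertex j - w)
        (tau%:K * side j) ((1 - tau)%:K * side j) n phi 0 0 1 =
      seg_mean n phi (w + tau%:K * vertex j) (vertex j) +
      seg_mean n phi (vertex j) (vertex j.+1) -
      seg_mean n phi (w + tau%:K * vertex j.+1) (vertex j.+1) -
      seg_mean n phi (w + tau%:K * vertex j) (w + tau%:K * vertex j.+1).
      by rewrite /quad_mean !add0r -!/(sigma j _ _); case: (S j) => -> -> -> ->.
    by rewrite !q vertex4; ring.
  (* The form [dz / (z - w)] is invariant under scaling about [w], so the small contour is moved
     back to the original one. *)
  have segE a b : seg_mean n phi (w + tau%:K * a) (w + tau%:K * b) =
      seg_mean n (fun z => f (w + tau%:K * z) * z^-1) a b.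
    rewrite /seg_mean.
    have -> : w + tau%:K * b - (w + tau%:K * a) = (b - a) * tau%:K by ring.
    rewrite -mulrA -mmeanZ; congr (_ * _); apply: eq_mmean => t _.
    have -> : w + tau%:K * a + t%:K * ((b - a) * tau%:K) =
        w + tau%:K * (a + t%:K * (b - a)) by ring.
    rewrite /phi; set z := a + _.
    have -> : w + tau%:K * z - w = tau%:K * z by ring.
    by rewrite invfM mulrCA mulVKf.
  under eq_bigr do rewrite segE.
  rewrite -square_meanE [X in cmod X](_ : _ =
    square_mean n (fun z => f (w + tau%:K * z) * z^-1) -
    f w * square_mean n (fun z => z^-1)); last by ring.
  rewrite -square_meanZ -square_meanB.
  have -> : g / 4 = 8 * s * (g / 64 * (2 / s)) by field; rewrite gt_eqF.
  apply: square_mean_le => z zs; have /andP[z1 z2] := on_square_bounds zs.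
  rewrite -mulrBl cmodM cmodV; apply: ler_pM; rewrite ?invr_ge0 ?cmod_ge0//.
    apply: hr; rewrite addrAC subrr add0r cmodM cmodR ger0_norm ?(ltW tau0)//.
    by apply: le_lt_trans taur; rewrite ler_wpM2l// ltW.
  by rewrite -[2 / s]invf_div lef_pV2// posrE; lra.
have h1 : clim (fun n => square_mean n phi - f w * square_mean n (fun z => z^-1) - Q n)
    (square_integral phi - f w * winding - 0) by exact: clim_sub.
have := @clim_le _ _ _ _ 0 (fun n _ => small n) h1; rewrite subr0 -/g; lra.
Qed.

End Formula.

End CauchyFormula.

(** * Taylor and Laurent expansions *)

Section Taylor.
Variable R : realType.
Local Notation C := R[i].
Local Notation "x %:K" := (x%:C%C : C) (at level 1, format "x %:K").
Implicit Types (f g : C -> C) (z w : C) (a b : nat -> C).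

(** Meant for [x = 1/(z - w)], [y = 1/(z - w')] and [d = w' - w], where [y = x + d * x * y] is the
    resolvent identity. As [T] depends only on [B] and [k], the error is uniform in [z] along the
    contour. *)
Lemma pow_inverse_expansion (B : R) k : 0 <= B -> exists T : R, 0 <= T /\
  forall x y d : C, cmod x <= B -> cmod y <= B -> y = x + d * x * y ->
    cmod (y ^+ k - x ^+ k - k%:R * d * x ^+ k.+1) <= T * cmod d ^+ 2.
Proof.
move=> B0; elim: k => [|k [T [T0 hT]]].
  by exists 0; split=> // x y d _ _ _; rewrite !expr0 mul0r mul0r subr0 subrr cmod0 mul0r.
exists (k.+1%:R * B ^+ k.+3 + B * T); split.
  by rewrite addr_ge0// mulr_ge0// exprn_ge0.
move=> x y d hx hy hxy.
have -> : y ^+ k.+1 - x ^+ k.+1 - k.+1%:R * d * x ^+ k.+2 =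
    k.+1%:R * (x ^+ k.+2 * y) * d ^+ 2 + y * (y ^+ k - x ^+ k - k%:R * d * x ^+ k.+1).
  rewrite !exprS -natr1; set X := x ^+ k; set Y := y ^+ k; set K := k%:R.
  have h : y - x - d * x * y = 0 by rewrite {1}hxy; ring.
  apply/eqP; rewrite -subr_eq0; apply/eqP.
  transitivity (X * (y - x - d * x * y) * (1 + (K + 1) * d * x)); first by ring.
  by rewrite h mulr0 mul0r.
rewrite mulrDl; apply: cmod_leD.
  rewrite cmodM cmodX ler_wpM2r ?exprn_ge0 ?cmod_ge0// cmodM cmod_nat ler_wpM2l//.
  have -> : B ^+ k.+3 = B ^+ k.+2 * B by rewrite exprSr.
  rewrite cmodM cmodX ler_pM ?exprn_ge0 ?cmod_ge0//.
  by rewrite lerXn2r ?nnegrE ?cmod_ge0.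
by rewrite cmodM -[leRHS]mulrA ler_pM ?cmod_ge0//; exact: hT.
Qed.

Section Disc.
Variable s : R.
Hypothesis s0 : 0 < s.
Variable f : C -> C.
Hypothesis f_diff : forall z, cmod z <= s -> cdiff f z.

Definition cauchy_integral (m : nat) w : C :=
  square_integral s (fun z => f z * (z - w)^-1 ^+ m.+1).

Lemma cdiff_cauchy_kernel m w z : cmod w <= s / 4 -> on_square s z ->
  cdiff (fun z => f z * (z - w)^-1 ^+ m) z.
Proof.
move=> ws zs; rewrite (_ : (fun z => _) = fun z => f z * ((z - w)^-1 ^+ m * z^-1 ^+ 0)).
  exact: (on_square_kernel s0 f_diff).
by apply/funext => x; rewrite expr0 mulr1.
Qed.

(** Differentiation under the integral: the second order error of the kernel is at most
    [T * cmod d ^+ 2] on the whole contour, hence at most [8 * s * (M * T) * cmod d ^+ 2] after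
    integration. *)
Lemma cderiv_cauchy_integral m w : cmod w < s / 4 ->
  cderiv (cauchy_integral m) w (m.+1%:R * cauchy_integral m.+1 w).
Proof.
move=> ws e e0; have s_gt0 := s0.
have [M [M0 hM]] := bounded_on_square s0 f_diff.
have [|T [T0 hT]] := @pow_inverse_expansion (4 / s) m.+1; first by rewrite divr_ge0// ltW.
have k0 : 0 < 8 * s * (M * T) + 1 by have : 0 <= s * (M * T) by [rewrite !mulr_ge0// ltW]; lra.
exists (Num.min (s / 4 - cmod w) (e / (8 * s * (M * T) + 1))).
  by rewrite lt_min divr_gt0// andbT subr_gt0.
move=> w'; rewrite lt_min => /andP[h1]; rewrite ltr_pdivlMr// => h2.
have ws' : cmod w' <= s / 4.
  have -> : w' = (w' - w) + w by rewrite subrK.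
  by apply: le_trans (cmodD _ _) _; lra.
have wsl := ltW ws.
pose d := w' - w.
have -> : cauchy_integral m w' - cauchy_integral m w - m.+1%:R * cauchy_integral m.+1 w * (w' - w) =
  square_integral s (fun z => (f z * (z - w')^-1 ^+ m.+1 - f z * (z - w)^-1 ^+ m.+1) -
     (m.+1%:R * d) * (f z * (z - w)^-1 ^+ m.+2)).
  have dK k u : cmod u <= s / 4 -> forall z, on_square s z ->
      cdiff (fun z => f z * (z - u)^-1 ^+ k) z by move=> *; exact: cdiff_cauchy_kernel.
  rewrite (square_integralB s0) ?(square_integralB s0) ?(square_integralZ s0).
  - by rewrite mulrAC.
  - exact: (dK m.+2 w).
  - exact: (dK m.+1 w').
  - exact: (dK m.+1 w).
  - by move=> z zs; apply: cdiffB; [exact: (dK m.+1 w')|exact: (dK m.+1 w)].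
  - by move=> z zs; apply: cdiffZ; exact: (dK m.+2 w).
have -> : (fun z => f z * (z - w')^-1 ^+ m.+1 - f z * (z - w)^-1 ^+ m.+1 -
    m.+1%:R * d * (f z * (z - w)^-1 ^+ m.+2)) =
  (fun z => f z * ((z - w')^-1 ^+ m.+1 - (z - w)^-1 ^+ m.+1 - m.+1%:R * d * (z - w)^-1 ^+ m.+2)).
  apply/funext => z; move: (f z) ((z - w')^-1 ^+ m.+1) ((z - w)^-1 ^+ m.+1)
    ((z - w)^-1 ^+ m.+2) (m.+1%:R * d) => *; ring.
apply: le_trans (_ : 8 * s * (M * (T * cmod d ^+ 2)) <= _).
  apply: (square_integral_le s0) => z zs.
    have [zw _] := on_square_sub_neq0 s0 zs wsl.
    have [zw' _] := on_square_sub_neq0 s0 zs ws'.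
    apply: cdiffM; first by apply: f_diff; case/andP: (on_square_bounds s0 zs).
    apply: cdiffB; first by apply: cdiffB; apply: cdiffX; exact: cdiff_inv_sub.
    by apply: cdiffZ; apply: cdiffX; exact: cdiff_inv_sub.
  have [zw b1] := on_square_sub_neq0 s0 zs wsl.
  have [zw' b2] := on_square_sub_neq0 s0 zs ws'.
  rewrite cmodM ler_pM ?cmod_ge0 ?hM// hT//.
  by rewrite /d; field; rewrite zw zw'.
rewrite -/d; have := cmod_ge0 d => d0.
have -> : 8 * s * (M * (T * cmod d ^+ 2)) = (8 * s * (M * T)) * cmod d * cmod d by ring.
by apply: ler_wpM2r => //; move: h2; rewrite -/d; lra.
Qed.

(** The formula at order [m] holds on an open disc and its right-hand side is differentiable, so it
    can be differentiated again; only first order differentiability of [f] is ever assumed. *)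
Lemma derive1n_cauchy_integral m w : cmod w < s / 4 ->
  derive1n m (f : Cplx R -> Cplx R) w = m`!%:R / winding s * cauchy_integral m w.
Proof.
elim: m w => [|m IH] w ws.
  rewrite fact0 mul1r /cauchy_integral.
  under [X in square_integral s X]eq_fun do rewrite expr1.
  by rewrite (cauchy_formula s0 f_diff (ltW ws)) mulrC mulfK ?winding_neq0.
rewrite derive1nS; apply: cderiv_derive1.
pose h z := m`!%:R / winding s * cauchy_integral m z.
apply: (@cderiv_near R h _ _ _ (s / 4 - cmod w)); first by rewrite subr_gt0.
  move=> z hz; rewrite IH//.
  have -> : z = (z - w) + w by rewrite subrK.
  by apply: le_lt_trans (cmodD _ _) _; rewrite -ltrBrDr.
move=> e e0; pose q := cmod (m`!%:R / winding s) + 1.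
have q0 : 0 < q by rewrite /q; have := cmod_ge0 (m`!%:R / winding s); lra.
have [r r0 hr] := cderiv_cauchy_integral m ws (divr_gt0 e0 q0).
exists r => // z /hr; rewrite /h factS natrM => hz.
have -> : m`!%:R / winding s * cauchy_integral m z - m`!%:R / winding s * cauchy_integral m w -
    m.+1%:R * m`!%:R / winding s * cauchy_integral m.+1 w * (z - w) =
  m`!%:R / winding s * (cauchy_integral m z - cauchy_integral m w -
     m.+1%:R * cauchy_integral m.+1 w * (z - w)).
  move: (cauchy_integral m z) (cauchy_integral m w) (cauchy_integral m.+1 w)
    (winding s)^-1 (m`!%:R : C) (m.+1%:R : C) => *; ring.
rewrite cmodM; apply: (@le_trans _ _ (q * (e / q * cmod (z - w)))).
  by apply: ler_pM => //; rewrite ?cmod_ge0// /q; lra.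
by rewrite mulrA mulrCA divff ?mulr1// gt_eqF.
Qed.

(** Finite geometric expansion of the kernel in [w / z], obtained by iterating
    [1/(z - w) = 1/z + w / (z (z - w))], with its exact remainder. *)
Lemma cauchy_integral_expansion n w : cmod w < s / 4 ->
  cauchy_integral 0 w - \sum_(k < n) cauchy_integral k 0 * w ^+ k =
  square_integral s (fun z => w ^+ n * (f z * ((z - w)^-1 ^+ 1 * z^-1 ^+ n))).
Proof.
move=> /ltW ws; elim: n => [|n IH].
  rewrite big_ord0 subr0; apply: eq_square_integral => // z zs.
  by rewrite !expr0 mul1r mulr1.
have w0 : cmod 0 <= s / 4 by rewrite cmod0 divr_ge0// ltW.
rewrite big_ord_recr /= opprD addrA IH mulrC -(square_integralZ s0); last first.
  by move=> z zs; exact: cdiff_cauchy_kernel.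
rewrite -(square_integralB s0); last first.
- by move=> z zs; apply: cdiffZ; exact: cdiff_cauchy_kernel.
- by move=> z zs; apply: cdiffZ; exact: (on_square_kernel s0 f_diff).
apply: eq_square_integral => // z zs; rewrite subr0.
have z0 := on_square_neq0 s0 zs.
have [zw _] := on_square_sub_neq0 s0 zs ws.
rewrite !expr1 !exprS; set Y := z^-1 ^+ n; set W := w ^+ n.
by field; rewrite z0 zw.
Qed.

(** In the remainder integral [8 * s] bounds the contour length, [M] bounds [f] and [4 / s] bounds
    [1/(z - w)], whence [32 * M]; bounding [1/z] by [4 / s] too gives the ratio
    [cmod w / (s / 4)]. *)
Lemma disc_taylor : exists B : R, 0 <= B /\ forall w, cmod w < s / 4 -> forall n,
  cmod (f w - \sum_(k < n) derive1n k (f : Cplx R -> Cplx R) 0 / k`!%:R * w ^+ k) <=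
  B * (cmod w / (s / 4)) ^+ n.
Proof.
have s_gt0 := s0; have [M [M0 hM]] := bounded_on_square s0 f_diff.
have c0 := winding_neq0 s0; have cc : 0 < cmod (winding s) by rewrite cmod_gt0.
exists (32 * M / cmod (winding s)); split; first by rewrite divr_ge0// ?mulr_ge0// ltW.
move=> w ws n.
have -> : f w - \sum_(k < n) derive1n k (f : Cplx R -> Cplx R) 0 / k`!%:R * w ^+ k =
    (winding s)^-1 * (cauchy_integral 0 w - \sum_(k < n) cauchy_integral k 0 * w ^+ k).
  rewrite mulrBr; congr (_ - _).
    have := derive1n_cauchy_integral 0 ws; rewrite derive1n0 fact0 mul1r; exact.
  rewrite mulr_sumr; apply: eq_bigr => k _; rewrite derive1n_cauchy_integral; last first.
    by rewrite cmod0 divr_gt0.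
  have k0 : k`!%:R != 0 :> C by rewrite pnatr_eq0 -lt0n fact_gt0.
  by field; rewrite c0 k0.
rewrite cauchy_integral_expansion// cmodM cmodV mulrC mulrAC ler_pM2r ?invr_gt0//.
have -> : 32 * M * (cmod w / (s / 4)) ^+ n =
   8 * s * (cmod w ^+ n * (M * ((4 / s) ^+ 1 * (4 / s) ^+ n))).
  rewrite expr1 invf_div exprMn; set X := (4 / s) ^+ n; field; rewrite gt_eqF//.
have wsl := ltW ws; apply: (square_integral_le s0) => z zs.
  by apply: cdiffZ; exact: (on_square_kernel s0 f_diff).
have [zw b1] := on_square_sub_neq0 s0 zs wsl.
have w0 : cmod 0 <= s / 4 by rewrite cmod0 divr_ge0// ltW.
have := (on_square_sub_neq0 s0 zs w0).2; rewrite subr0 => b2.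
rewrite !cmodM !cmodX.
have p4 : 0 <= 4 / s by rewrite divr_ge0// ltW.
rewrite !expr1 ler_wpM2l ?exprn_ge0 ?cmod_ge0// ler_pM ?mulr_ge0 ?exprn_ge0 ?cmod_ge0 ?hM//.
by rewrite ler_pM ?exprn_ge0 ?cmod_ge0// lerXn2r ?nnegrE ?cmod_ge0.
Qed.

End Disc.

(* The geometric bound on the remainders encodes convergence of the series to
   [f]; as it also controls each remainder near 0, it passes to quotients by
   powers of the variable. *)
Definition has_taylor f a := exists rho B : R, [/\ 0 < rho, 0 <= B &
  forall w, cmod w < rho -> forall n,
    cmod (f w - \sum_(k < n) a k * w ^+ k) <= B * (cmod w / rho) ^+ n].

Definition taylor_coef f (k : nat) : C := derive1n k (f : Cplx R -> Cplx R) 0 / k`!%:R.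

Lemma holomorphic_atP f (p : C) : @holomorphic_at R (Cplx R) f p <->
  exists2 r : R, 0 < r & forall z, cmod (z - p) < r -> cdiff f z.
Proof.
rewrite /holomorphic_at; split.
- by move=> /near_cmodP [r r0 h]; exists r => // z /h /derivable1_diffP.
- by move=> [r r0 h]; apply/near_cmodP; exists r => // z /h /derivable1_diffP.
Qed.

Lemma holomorphic_at0D f g : @holomorphic_at R (Cplx R) f 0 ->
  @holomorphic_at R (Cplx R) g 0 -> @holomorphic_at R (Cplx R) (fun z => f z + g z) 0.
Proof.
move=> /(holomorphic_atP f 0) [r r0 h] /(holomorphic_atP g 0) [r' r0' h'].
apply: (holomorphic_atP (fun z => f z + g z) 0).2.
exists (Num.min r r'); first by rewrite lt_min r0.
by move=> z; rewrite lt_min => /andP[z1 z2]; apply: cdiffD; [exact: h|exact: h'].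
Qed.

Lemma holomorphic_at0_mul_poly c d f : @holomorphic_at R (Cplx R) f 0 ->
  @holomorphic_at R (Cplx R) (fun z => c * (z ^+ d * f z)) 0.
Proof.
move=> /(holomorphic_atP f 0) [r r0 h].
apply: (holomorphic_atP (fun z => c * (z ^+ d * f z)) 0).2.
exists r; first by [].
move=> z zr; apply: cdiffZ; apply: cdiffM; last exact: h.
by apply: cdiffX; exact: cdiff_id.
Qed.

Lemma holomorphic_at0_sum (I : eqType) (r : seq I) (F : I -> C -> C) :
  (forall i, i \in r -> @holomorphic_at R (Cplx R) (F i) 0) ->
  @holomorphic_at R (Cplx R) (fun z => \sum_(i <- r) F i z) 0.
Proof.
elim: r => [|i r IH] h.
  apply: (holomorphic_atP (fun z => \sum_(i <- [::]) F i z) 0).2; exists 1; first by [].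
  move=> z _; rewrite (_ : (fun z => _) = fun=> 0); first exact: cdiff_cst.
  by apply/funext => x; rewrite big_nil.
rewrite (_ : (fun z => _) = fun z => F i z + \sum_(j <- r) F j z); last first.
  by apply/funext => x; rewrite big_cons.
apply: holomorphic_at0D; first by apply: h; rewrite mem_head.
by apply: IH => j jr; apply: h; rewrite in_cons jr orbT.
Qed.

Lemma holomorphic_taylor f : @holomorphic_at R (Cplx R) f 0 -> has_taylor f (taylor_coef f).
Proof.
move=> /holomorphic_atP [r r0 h]; have r2 : 0 < r / 2 by lra.
have [|B [B0 hB]] := @disc_taylor (r / 2) r2 f.
  by move=> z hz; apply: h; rewrite subr0; lra.
(* Halving [r] fits a closed disc inside the open one; the quarter is the range of [disc_taylor]. *)
by exists (r / 2 / 4), B; split=> //; lra.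
Qed.

Lemma geometric_bound_le (B r r' : R) w n : 0 <= B -> 0 < r' -> r' <= r ->
  B * (cmod w / r) ^+ n <= B * (cmod w / r') ^+ n.
Proof.
move=> B0 r0 rr; have r1 : 0 < r by apply: lt_le_trans rr.
rewrite ler_wpM2l// lerXn2r ?nnegrE ?divr_ge0 ?cmod_ge0 ?(ltW r0) ?(ltW r1)//.
by rewrite ler_wpM2l ?cmod_ge0// lef_pV2 ?posrE.
Qed.

Lemma has_taylorD f g a b : has_taylor f a -> has_taylor g b ->
  has_taylor (fun z => f z + g z) (fun k => a k + b k).
Proof.
move=> [r [B [r0 B0 h]]] [r' [B' [r0' B0' h']]].
have m0 : 0 < Num.min r r' by rewrite lt_min r0.
exists (Num.min r r'), (B + B'); split; rewrite ?addr_ge0//.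
move=> w; rewrite lt_min => /andP[w1 w2] n.
have -> : f w + g w - \sum_(k < n) (a k + b k) * w ^+ k =
    (f w - \sum_(k < n) a k * w ^+ k) + (g w - \sum_(k < n) b k * w ^+ k).
  by under eq_bigr do rewrite mulrDl; rewrite big_split /=; ring.
rewrite mulrDl; apply: cmod_leD.
  by apply: le_trans (h w w1 n) (geometric_bound_le _ _ _ _ _); rewrite ?ge_min ?lexx.
by apply: le_trans (h' w w2 n) (geometric_bound_le _ _ _ _ _); rewrite ?ge_min ?lexx ?orbT.
Qed.

Lemma has_taylorZ c f a : has_taylor f a -> has_taylor (fun z => c * f z) (fun k => c * a k).
Proof.
move=> [r [B [r0 B0 h]]]; exists r, (cmod c * B); split; rewrite ?mulr_ge0 ?cmod_ge0//.
move=> w wr n; rewrite -[leRHS]mulrA.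
under eq_bigr do rewrite -mulrA.
by rewrite -mulr_sumr -mulrBr cmodM ler_wpM2l ?cmod_ge0//; exact: h.
Qed.

Lemma has_taylor_near f g a r : 0 < r -> (forall w, cmod w < r -> f w = g w) ->
  has_taylor f a -> has_taylor g a.
Proof.
move=> r0 hr [r' [B [r0' B0 h]]].
have m0 : 0 < Num.min r r' by rewrite lt_min r0.
exists (Num.min r r'), B; split=> // w; rewrite lt_min => /andP[w1 w2] n.
rewrite -hr//; apply: le_trans (h w w2 n) (geometric_bound_le _ _ _ _ _) => //.
by rewrite ge_min lexx orbT.
Qed.

(** Once the lower coefficients vanish, the partial sum up to [n] is [a n * w ^+ n], yet it is
    bounded by a multiple of the power [n + 1] of [cmod w]; a small [w] then forces [a n = 0]. *)
Lemma small_power_series_eq0 a (r B : R) : 0 < r -> 0 <= B ->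
  (forall w, w != 0 -> cmod w < r -> forall n,
    cmod (\sum_(k < n) a k * w ^+ k) <= B * (cmod w / r) ^+ n) -> forall n, a n = 0.
Proof.
move=> r0 B0 h n; elim/ltn_ind: n => n IH.
apply/eqP; rewrite -cmod_eq0; apply/negPn/negP => n0.
have g0 : 0 < cmod (a n) by rewrite lt_neqAle eq_sym n0 cmod_ge0.
set g := cmod _ in g0.
have K0 : 0 < B / r ^+ n.+1 + 1.
  by have : 0 <= B / r ^+ n.+1 by [rewrite divr_ge0// exprn_ge0// ltW]; lra.
pose x := Num.min (r / 2) (g / (2 * (B / r ^+ n.+1 + 1))).
have x0 : 0 < x by rewrite lt_min; apply/andP; split; [lra|rewrite divr_gt0// mulr_gt0].
have xr : x < r by apply: (@le_lt_trans _ _ (r / 2)); [rewrite ge_min lexx|lra].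
have xg : x * (B / r ^+ n.+1 + 1) < g.
  have : x <= g / (2 * (B / r ^+ n.+1 + 1)) by rewrite ge_min lexx orbT.
  by rewrite ler_pdivlMr ?mulr_gt0//; lra.
have xK : cmod x%:K = x by rewrite cmodR ger0_norm// ltW.
have xK0 : x%:K != 0 by rewrite -cmod_gt0 xK.
have := h x%:K xK0; rewrite xK => /(_ xr n.+1); rewrite big_ord_recr /= big1; last first.
  by move=> k _; rewrite IH// mul0r.
rewrite add0r cmodM cmodX xK -/g => hx.
have xn : 0 < x ^+ n by rewrite exprn_gt0.
suff : g <= B / r ^+ n.+1 * x by lra.
rewrite -(ler_pM2r xn); apply: le_trans hx _.
rewrite (_ : B * _ = B / r ^+ n.+1 * x * x ^+ n)// expr_div_n [x ^+ n.+1]exprS.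
by ring.
Qed.

Lemma has_taylor_uniq f a b : has_taylor f a -> has_taylor f b -> a =1 b.
Proof.
move=> ha hb.
have [r [B [r0 B0 h]]] : has_taylor (fun=> 0) (fun k => a k - b k).
  have := has_taylorD ha (has_taylorZ (-1) hb).
  under eq_fun do rewrite mulN1r subrr.
  by under [X in has_taylor _ X]eq_fun do rewrite mulN1r.
move=> n; apply/eqP; rewrite -subr_eq0; apply/eqP; move: n.
apply: (small_power_series_eq0 r0 B0) => w _ wr n.
by have := h w wr n; rewrite sub0r cmodN.
Qed.

Lemma has_taylor_sum (I : eqType) (r : seq I) (F : I -> C -> C) (c : I -> nat -> C) :
  (forall i, i \in r -> has_taylor (F i) (c i)) ->
  has_taylor (fun z => \sum_(i <- r) F i z) (fun k => \sum_(i <- r) c i k).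
Proof.
elim: r => [|i r IH] h.
  exists 1, 0; split=> // w _ n; rewrite mul0r big_nil big1 ?subrr ?cmod0//.
  by move=> k _; rewrite big_nil mul0r.
under eq_fun do rewrite big_cons.
under [X in has_taylor _ X]eq_fun do rewrite big_cons.
apply: has_taylorD; first by apply: h; rewrite mem_head.
by apply: IH => j jr; apply: h; rewrite in_cons jr orbT.
Qed.

Lemma has_taylor_mulXn f a d : has_taylor f a ->
  has_taylor (fun z => z ^+ d * f z) (fun k => if (k < d)%N then 0 else a (k - d)%N).
Proof.
move=> [r [B [r0 B0 h]]]; exists r, (B * r ^+ d).
have rd : 0 < r ^+ d by rewrite exprn_gt0.
split; rewrite ?mulr_ge0 ?(ltW rd)//.
move=> w wr n.
have E m : B * r ^+ d * (cmod w / r) ^+ (d + m) = cmod w ^+ d * (B * (cmod w / r) ^+ m).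
  by rewrite exprD [(cmod w / r) ^+ d]expr_div_n; field; rewrite gt_eqF.
have [nd|dn] := leqP n d.
  rewrite big1 ?subr0; last by move=> k _; rewrite (leq_trans (ltn_ord k) nd) mul0r.
  apply: (@le_trans _ _ (B * r ^+ d * (cmod w / r) ^+ (d + 0))).
    rewrite E cmodM cmodX ler_wpM2l ?exprn_ge0 ?cmod_ge0//.
    by have := h w wr 0%N; rewrite big_ord0 subr0.
  rewrite addn0 ler_wpM2l ?mulr_ge0 ?(ltW rd)// ler_wiXn2l ?divr_ge0 ?cmod_ge0 ?(ltW r0)//.
  by rewrite ler_pdivrMr// mul1r ltW.
rewrite -(subnKC (ltnW dn)); set m := (n - d)%N.
rewrite E big_split_ord /= big1 ?add0r; last by move=> k _; rewrite ltn_ord mul0r.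
have -> : \sum_(i < m) (if (d + i < d)%N then 0 else a (d + i - d)%N) * w ^+ (d + i) =
    w ^+ d * \sum_(i < m) a i * w ^+ i.
  rewrite mulr_sumr; apply: eq_bigr => k _.
  by rewrite ltnNge leq_addr /= addKn exprD mulrCA.
by rewrite -mulrBr cmodM cmodX ler_wpM2l ?exprn_ge0 ?cmod_ge0//; exact: h.
Qed.

Lemma has_taylor0 f a : has_taylor f a -> f 0 = a 0%N.
Proof.
move=> [r [B [r0 B0 h]]]; have := h 0; rewrite cmod0 => /(_ r0 1%N).
rewrite mul0r expr1 mulr0 big_ord_recr big_ord0 /= add0r expr0 mulr1 => h0.
by apply/eqP; rewrite -subr_eq0 -cmod_eq0 eq_le cmod_ge0 h0.
Qed.

Lemma has_taylor_cderiv f a : has_taylor f a -> cderiv f 0 (a 1%N).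
Proof.
move=> hf; have f0 := has_taylor0 hf; move: hf => [r [B [r0 B0 h]]] e e0.
have B1 : 0 < B + 1 by lra.
exists (Num.min r (e * r ^+ 2 / (B + 1))).
  by rewrite lt_min r0 divr_gt0// mulr_gt0// exprn_gt0.
move=> z; rewrite subr0 lt_min ltr_pdivlMr// => /andP[z1 z2].
have := h z z1 2; rewrite !big_ord_recr big_ord0 /= add0r expr0 expr1 mulr1 opprD addrA -f0.
move/le_trans; apply; rewrite expr_div_n.
have -> : B * (cmod z ^+ 2 / r ^+ 2) = (cmod z * B / r ^+ 2) * cmod z by ring.
apply: ler_wpM2r; first exact: cmod_ge0.
rewrite ler_pdivrMr ?exprn_gt0//; have := cmod_ge0 z; lra.
Qed.

(** The value at 0 fills the removable singularity. *)
Definition taylor_quot f a (d : nat) z : C :=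
  if z == 0 then a d else (f z - \sum_(k < d) a k * z ^+ k) / z ^+ d.

Lemma taylor_quotE f a d z : f 0 = a 0%N ->
  f z = \sum_(k < d) a k * z ^+ k + z ^+ d * taylor_quot f a d z.
Proof.
move=> f0; rewrite /taylor_quot; have [->|z0] := eqVneq z 0; last first.
  by rewrite mulrC divfK ?expf_neq0// addrC subrK.
case: d => [|d]; first by rewrite big_ord0 add0r expr0 mul1r.
rewrite big_ord_recl expr0 mulr1 big1 ?addr0 ?expr0n ?mul0r ?addr0//.
by move=> k _; rewrite lift0 expr0n mulr0.
Qed.

Lemma taylor_coef_bound f a : has_taylor f a ->
  exists r B : R, 0 < r /\ forall k, cmod (a k) <= B / r ^+ k.
Proof.
move=> [r [B [r0 B0 h]]]; have r2 : 0 < r / 2 by lra.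
exists (r / 2), (2 * B); split=> // k.
have xK : cmod (r / 2)%:K = r / 2 by rewrite cmodR ger0_norm// ltW.
have hr : cmod (r / 2)%:K < r by rewrite xK; lra.
rewrite ler_pdivlMr ?exprn_gt0// -[X in _ * X ^+ _]xK -cmodX -cmodM.
have := h _ hr k.+1; have := h _ hr k; rewrite xK.
set x := (r / 2)%:K; set S := \sum_(i < k) _.
rewrite (_ : \sum_(i < k.+1) a i * x ^+ i = S + a k * x ^+ k); last by rewrite big_ord_recr.
set T := a k * _; set F := f _ => h2 h1.
have -> : T = (F - S) - (F - (S + T)) by ring.
have -> : 2 * B = B + B by ring.
have q n : B * (r / 2 / r) ^+ n <= B.
  have -> : r / 2 / r = 2^-1 by field; rewrite gt_eqF.
  by apply: ler_piMr => //; apply: exprn_ile1; lra.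
by apply: cmod_leB; [exact: le_trans h2 (q _)|exact: le_trans h1 (q _)].
Qed.

Lemma has_taylor_quot f a d : has_taylor f a ->
  has_taylor (taylor_quot f a d) (fun k => a (d + k)%N).
Proof.
move=> hf; have [r' [B' [r'0 hB']]] := taylor_coef_bound hf.
move: hf => [r [B [r0 B0 h]]]; have rd : 0 < r ^+ d by rewrite exprn_gt0.
(* The second entry of the maximum covers [w = 0] and [n = 0], where the remainder is the value
   [a d]. *)
exists r, (Num.max (B / r ^+ d) (cmod (a d))).
split=> //; first by rewrite le_max cmod_ge0 orbT.
move=> w wr n; rewrite /taylor_quot; have [->|w0] := eqVneq w 0.
  case: n => [|n]; first by rewrite big_ord0 subr0 expr0 mulr1 le_max lexx orbT.
  rewrite big_ord_recl addn0 expr0 mulr1 big1 ?addr0 ?subrr ?cmod0.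
    by rewrite mul0r expr0n mulr0.
  by move=> k _; rewrite lift0 expr0n mulr0.
have wd : w ^+ d != 0 by rewrite expf_neq0.
have -> : (f w - \sum_(k < d) a k * w ^+ k) / w ^+ d - \sum_(k < n) a (d + k)%N * w ^+ k =
    (f w - \sum_(k < d + n) a k * w ^+ k) / w ^+ d.
  rewrite big_split_ord /= opprD addrA [RHS]mulrBl; congr (_ - _).
  rewrite mulr_suml; apply: eq_bigr => k _; rewrite exprD.
  by field.
rewrite cmodM cmodV cmodX ler_pdivrMr ?exprn_gt0 ?cmod_gt0//.
apply: le_trans (h w wr _) _.
have -> : B * (cmod w / r) ^+ (d + n) = B / r ^+ d * ((cmod w / r) ^+ n * cmod w ^+ d).
  by rewrite exprD expr_div_n; ring.
rewrite -[leRHS]mulrA ler_wpM2r ?le_max ?lexx//.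
by rewrite mulr_ge0// exprn_ge0// ?divr_ge0// ?cmod_ge0// ltW.
Qed.

(** Away from 0 the usual rules apply; at 0 the derivative is read off the Taylor expansion of the
    quotient. *)
Lemma holomorphic_taylor_quot f a d : @holomorphic_at R (Cplx R) f 0 -> has_taylor f a ->
  @holomorphic_at R (Cplx R) (taylor_quot f a d) 0.
Proof.
move=> /(holomorphic_atP f 0) [r r0 hr] hf.
apply: (holomorphic_atP (taylor_quot f a d) 0).2; exists r; first by [].
move=> z zr.
have [->|z0] := eqVneq z 0.
  apply/cdiffP; exists (a (d + 1)%N).
  exact: (has_taylor_cderiv (has_taylor_quot d hf)).
have z0' : 0 < cmod z by rewrite cmod_gt0.
have hd : cdiff (fun z => (f z - \sum_(k < d) a k * z ^+ k) * z^-1 ^+ d) z.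
  apply: cdiffM; last by apply: cdiffX; exact: cdiff_inv.
  apply: cdiffB; first exact: hr.
  elim: d => [|m IH].
    rewrite (_ : (fun z => _) = fun=> 0); first exact: cdiff_cst.
    by apply/funext => x; rewrite big_ord0.
  rewrite (_ : (fun z => _) = fun x => \sum_(k < m) a k * x ^+ k + a m * x ^+ m).
    by apply: cdiffD; [exact: IH|apply: cdiffZ; apply: cdiffX; exact: cdiff_id].
  by apply/funext => x; rewrite big_ord_recr.
have [e he] := (cdiffP _ _).1 hd; apply/cdiffP; exists e.
apply: cderiv_near z0' _ he => x hx; rewrite /taylor_quot.
have x0 : x != 0.
  by apply/eqP => x0; move: hx; rewrite x0 sub0r cmodN ltxx.
by rewrite (negPf x0) exprVn.
Qed.

End Taylor.

(** * Uniqueness of Laurent expansions, pole orders and zero orders *)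

Section Laurent.
Variable R : realType.
Local Notation C := R[i].
Local Notation hol0 f := (@holomorphic_at R (Cplx R) f 0).
Implicit Types (f g : C -> C) (z w t : C) (b : nat -> C) (a : int -> C).

Lemma clim_cvgP (u : nat -> C) (l : C) :
  clim u l <-> ((u : nat -> Cplx R) @ \oo --> (l : Cplx R)).
Proof.
split=> [h|/cvgrPdist_le h e e0].
- apply/cvgrPdist_le => e e0.
  have eE : e = (complex.Re e)%:C%C by rewrite RRe_real// ger0_real// ltW.
  have e0' : 0 < complex.Re e by move: e0; rewrite {1}eE ltcR.
  have [N hN] := h _ e0'; exists N => // n /= /hN hn.
  by rewrite eE norm_cmod lecR cmodC.
- have e0' : (0 : R[i]) < e%:C%C by rewrite ltcR.
  have [N _ hN] := h _ e0'; exists N => n /hN /=.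
  by rewrite norm_cmod lecR cmodC.
Qed.

(** Convergence at the single point [r / 2] bounds the terms there, so on the disc of radius [r / 4]
    the tails decay geometrically and [small_power_series_eq0] applies. *)
Lemma power_series_eq0 b (r : R) : 0 < r ->
  (forall t, t != 0 -> cmod t < r -> clim (fun n => \sum_(k < n) b k * t ^+ k) 0) ->
  forall n, b n = 0.
Proof.
move=> r0 h; pose t0 := (r / 2)%:C%C : C.
have t0E : cmod t0 = r / 2 by rewrite cmodR ger0_norm//; lra.
have t00 : t0 != 0 by rewrite -cmod_gt0 t0E; lra.
have [N hN] := h t0 t00 ltac:(rewrite t0E; lra) 1 ltr01.
(* From index [N] on, a term is the difference of two partial sums of modulus at most 1, whence the
   2; the sum covers the earlier terms. *)
pose K := 2 + \sum_(k < N) cmod (b k * t0 ^+ k).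
have S0 : 0 <= \sum_(k < N) cmod (b k * t0 ^+ k) by apply: sumr_ge0 => *; exact: cmod_ge0.
have hK k : cmod (b k * t0 ^+ k) <= K.
  have [Nk|kN] := leqP N k.
    apply: (@le_trans _ _ 2); last by rewrite /K; lra.
    have := hN k Nk; have := hN k.+1 (leqW Nk); rewrite !subr0.
    rewrite (_ : \sum_(i < k.+1) b i * t0 ^+ i = \sum_(i < k) b i * t0 ^+ i + b k * t0 ^+ k);
      last by rewrite big_ord_recr.
    set S := \sum_(i < k) _; set T := b k * _ => h1 h2.
    have -> : T = (S + T) - S by ring.
    have -> : 2 = 1 + 1 :> R by ring.
    exact: cmod_leB.
  rewrite /K (bigD1 (Ordinal kN))//= addrCA lerDl addr_ge0//.
  by apply: sumr_ge0 => *; exact: cmod_ge0.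
have K0 : 0 <= K by rewrite /K; lra.
apply: (@small_power_series_eq0 _ _ (r / 4) (2 * K)); [lra|lra|].
move=> w w0 wr n; set q := cmod w / (r / 2).
have q0 : 0 <= q by rewrite divr_ge0 ?cmod_ge0//; lra.
have q2 : q <= 2^-1 by rewrite ler_pdivrMr; lra.
have bk k : cmod (b k * w ^+ k) <= K * q ^+ k.
  have -> : b k * w ^+ k = b k * t0 ^+ k * (w / t0) ^+ k.
    by rewrite -mulrA -exprMn [t0 * _]mulrC divfK.
  by rewrite cmodM cmodX [cmod (w / t0)]cmodM cmodV t0E ler_wpM2r// exprn_ge0.
(* The added term [2 * K * q ^+ (n + j)] pays for the next summand, because [q] is at most [1/2]. *)
have step j : cmod (\sum_(k < n + j) b k * w ^+ k - \sum_(k < n) b k * w ^+ k) +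
    2 * K * q ^+ (n + j) <= 2 * K * q ^+ n.
  elim: j => [|j IH]; first by rewrite addn0 subrr cmod0 add0r.
  apply: le_trans IH; rewrite addnS big_ord_recr /=; set S := \sum_(k < n + j) _.
  have := cmodD (S - \sum_(k < n) b k * w ^+ k) (b (n + j)%N * w ^+ (n + j)).
  rewrite addrAC; have := bk (n + j)%N.
  have qn : 0 <= q ^+ (n + j) by rewrite exprn_ge0.
  have : K * q ^+ (n + j).+1 <= K * (2^-1 * q ^+ (n + j)) by rewrite exprS ler_wpM2l// ler_wpM2r.
  by lra.
have hw : clim (fun m => \sum_(k < m) b k * w ^+ k - \sum_(k < n) b k * w ^+ k)
    (0 - \sum_(k < n) b k * w ^+ k).
  by apply: clim_sub; [apply: h => //; lra|exact: clim_cst].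
have := @clim_le _ _ _ (2 * K * q ^+ n) n _ hw; rewrite sub0r cmodN => hle.
apply: le_trans (hle _) _.
  move=> m /subnKC <-; have := step (m - n)%N.
  have : 0 <= 2 * K * q ^+ (n + (m - n)) by rewrite !mulr_ge0// exprn_ge0.
  by lra.
apply: geometric_bound_le; lra.
Qed.

(* Clearing the denominator turns an expansion with principal part of length at
   most [N] into a power series for [t ^+ P * f t], for every [P >= N]. *)
Lemma laurent_expansion_series f a : laurent_expansion (f : Cplx R -> Cplx R) a ->
  exists N : nat, (forall k : int, k < - N%:Z -> a k = 0) /\
    forall M : nat, exists2 r : R, 0 < r & forall t, t != 0 -> cmod t < r ->
      clim (fun n => \sum_(k < n) a (k%:Z - (N + M)%:Z) * t ^+ k) (t ^+ (N + M) * f t).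
Proof.
move=> [N [aN /near0_cmodP [r r0 h]]]; exists N; split=> // M; exists r => // t t0 tr.
have /clim_cvgP h1 := h t t0 tr.
move=> e e0; have [n0 hn0] := clim_mul (t ^+ (N + M)) h1 e0.
exists (n0 + M)%N => n hn.
have [m nE] : exists m, n = (M + m)%N by exists (n - M)%N; lia.
have := hn0 m; rewrite -(leq_add2l M) [(M + n0)%N]addnC -nE hn => /(_ isT).
suff -> : \sum_(k < n) a (k%:Z - (N + M)%:Z) * t ^+ k =
   t ^+ (N + M) * series (fun n : nat => a (n%:Z - N%:Z) * t ^ (n%:Z - N%:Z)) m by [].
rewrite nE big_split_ord /= big1 ?add0r; last first.
  by move=> k _; rewrite aN ?mul0r//; have := ltn_ord k; lia.
rewrite /series /= big_mkord mulr_sumr; apply: eq_bigr => k _.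
have -> : (M + k)%:Z - (N + M)%:Z = k%:Z - N%:Z by lia.
rewrite mulrCA; congr (_ * _); rewrite !exprnP -expfzDr//.
by congr (_ ^ _); lia.
Qed.

Lemma laurent_expansion_uniq f a a' : laurent_expansion (f : Cplx R -> Cplx R) a ->
  laurent_expansion (f : Cplx R -> Cplx R) a' -> a =1 a'.
Proof.
move=> /laurent_expansion_series [N [aN h]] /laurent_expansion_series [N' [aN' h']].
(* Each expansion is shifted by the other's bound, so both describe [t ^+ (N + N') * f t]. *)
have [r r0 hr] := h N'; have [r' r'0 hr'] := h' N.
have e0 n : a (n%:Z - (N + N')%:Z) - a' (n%:Z - (N + N')%:Z) = 0.
  move: n; apply: (@power_series_eq0 (fun n => a (n%:Z - (N + N')%:Z) - a' (n%:Z - (N + N')%:Z))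
    (Num.min r r')); first by rewrite lt_min r0.
  move=> t t0; rewrite lt_min => /andP[t1 t2].
  have := clim_sub (hr t t0 t1) (hr' t t0 t2); rewrite addnC subrr.
  congr clim; apply/funext => n.
  by rewrite -sumrB; apply: eq_bigr => k _; rewrite mulrBl.
move=> k; have [kN|kN] := ltP k (- (N + N')%:Z).
  by rewrite aN ?aN'//; lia.
have -> : k = (absz (k + (N + N')%:Z)%R)%:Z - (N + N')%:Z by lia.
by apply/eqP; rewrite -subr_eq0 e0.
Qed.

Lemma laurent_coef_eq f a k : laurent_expansion (f : Cplx R -> Cplx R) a ->
  laurent_coef (f : Cplx R -> Cplx R) k = a k.
Proof.
move=> h; rewrite /laurent_coef; case: xgetP => [c _ [a' h' ->]|/(_ (a k)) []].
  exact: (laurent_expansion_uniq h' h k).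
by exists a.
Qed.

(** The guard is essential, since [absz] would fold indices below [- N] back onto Taylor
    coefficients. *)
Definition laurent_of_taylor (N : nat) b (k : int) : C :=
  if k < - N%:Z then 0 else b (absz (k + N%:Z)).

Lemma laurent_expansion_quot f g b (N : nat) (r : R) : 0 < r ->
  (forall t, t != 0 -> cmod t < r -> f t = g t / t ^+ N) -> has_taylor g b ->
  laurent_expansion (f : Cplx R -> Cplx R) (laurent_of_taylor N b).
Proof.
move=> r0 hf [r' [B [r'0 B0 h]]]; exists N; split.
  by move=> k kN; rewrite /laurent_of_taylor kN.
apply/near0_cmodP; exists (Num.min r r'); first by rewrite lt_min r0.
move=> t t0; rewrite lt_min => /andP[t1 t2]; apply/clim_cvgP.
rewrite hf//.
have E n : series (fun n : nat => laurent_of_taylor N b (n%:Z - N%:Z) * t ^ (n%:Z - N%:Z)) n =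
    (t ^+ N)^-1 * \sum_(k < n) b k * t ^+ k.
  rewrite /series /= big_mkord mulr_sumr; apply: eq_bigr => k _.
  rewrite /laurent_of_taylor ifF; last by lia.
  rewrite subrK absz_nat mulrCA; congr (_ * _).
  by rewrite expfzDr// exprnP exprnN mulrC.
rewrite (_ : series _ = (fun n => (t ^+ N)^-1 * \sum_(k < n) b k * t ^+ k)); last exact/funext.
rewrite mulrC; apply: clim_mul => e e0.
have q1 : `|cmod t / r'| < 1.
  by rewrite ger0_norm ?divr_ge0 ?cmod_ge0 ?(ltW r'0)// ltr_pdivrMr// mul1r.
have B1 : 0 < B + 1 by lra.
have /cvgrPdist_le /(_ _ (divr_gt0 e0 B1)) [n0 _ hn0] := cvg_expr q1.
exists n0 => n /hn0 /=; rewrite sub0r normrN => hn.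
have qn : (cmod t / r') ^+ n <= e / (B + 1) by apply: le_trans (ler_norm _) hn.
rewrite cmodC; apply: le_trans (h t t2 n) _.
have q0 : 0 <= (cmod t / r') ^+ n by rewrite exprn_ge0// divr_ge0 ?cmod_ge0 ?(ltW r'0).
by move: qn; rewrite ler_pdivlMr// => qn; nra.
Qed.

Lemma has_pole_order_laurent f n : has_pole_order (f : Cplx R -> Cplx R) n ->
  exists a, [/\ laurent_expansion (f : Cplx R -> Cplx R) a,
    forall k : int, k < - n%:Z -> a k = 0 & (0 < n)%N -> a (- n%:Z) != 0].
Proof.
case: n => [|n] /=.
- move=> [g hg /near0_cmodP [r r0 h]].
  exists (laurent_of_taylor 0 (taylor_coef g)); split=> //.
    apply: (laurent_expansion_quot r0 _ (holomorphic_taylor hg)) => t t0 tr.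
    by rewrite h// expr0 divr1.
  by move=> k kN; rewrite /laurent_of_taylor kN.
- move=> [g [hg g0 /near0_cmodP [r r0 h]]].
  exists (laurent_of_taylor n.+1 (taylor_coef g)); split=> //.
  + exact: (laurent_expansion_quot r0 h (holomorphic_taylor hg)).
  + by move=> k kN; rewrite /laurent_of_taylor kN.
  + move=> _; rewrite /laurent_of_taylor ltxx addNr absz0.
    by rewrite -(has_taylor0 (holomorphic_taylor hg)).
Qed.

Lemma has_pole_order_uniq f n n' : has_pole_order (f : Cplx R -> Cplx R) n ->
  has_pole_order (f : Cplx R -> Cplx R) n' -> n = n'.
Proof.
move=> /has_pole_order_laurent [a [h1 h2 h3]] /has_pole_order_laurent [a' [h1' h2' h3']].
have aa := laurent_expansion_uniq h1 h1'.
have [nn|nn|//] := ltngtP n n'.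
- by have := h3' (leq_ltn_trans (leq0n _) nn); rewrite -aa h2 ?eqxx//; lia.
- by have := h3 (leq_ltn_trans (leq0n _) nn); rewrite aa h2' ?eqxx//; lia.
Qed.

Lemma pole_order_eq f n : has_pole_order (f : Cplx R -> Cplx R) n ->
  pole_order (f : Cplx R -> Cplx R) = n.
Proof.
move=> h; rewrite /pole_order; case: xgetP => [m _ hm|/(_ n)//].
exact: has_pole_order_uniq hm h.
Qed.

Lemma nat_max_eq (A : set nat) n : A n -> (forall k, A k -> (k <= n)%N) -> nat_max A = n.
Proof.
move=> An hn; rewrite /nat_max; case: xgetP => [m _ [Am hm]|/(_ n) []//].
by apply/eqP; rewrite eqn_leq hm// hn.
Qed.

Lemma nat_max_bounded (A : set nat) N n : (forall k, A k -> (k <= N)%N) -> A n ->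
  A (nat_max A) /\ forall k, A k -> (k <= nat_max A)%N.
Proof.
move=> hN An.
have ex : exists n, `[< A n >] by exists n; apply/asboolP.
have ub k : `[< A k >] -> (k <= N)%N by move=> /asboolP; exact: hN.
have [m /asboolP Am hm] := ex_maxnP ex ub.
have hm' k : A k -> (k <= m)%N by move=> Ak; apply: hm; apply/asboolP.
by rewrite (nat_max_eq Am hm').
Qed.

Lemma nat_max0 (A : set nat) : (forall k, ~ A k) -> nat_max A = 0%N.
Proof. by move=> h; rewrite /nat_max; case: xgetP => // m _ [/h]. Qed.

(** If [d < N] is the least index of a nonzero Taylor coefficient of [g], dividing out [t ^+ d]
    leaves a pole of order exactly [N - d]; if there is none, [t ^+ N] divides [g] and the quotient
    extends. *)
Lemma pole_order_quot f g (N : nat) (r : R) (D := laurent_coef (f : Cplx R -> Cplx R)) :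
  0 < r -> (forall t, t != 0 -> cmod t < r -> f t = g t / t ^+ N) -> hol0 g ->
  has_pole_order (f : Cplx R -> Cplx R) (nat_max [set m | (1 <= m)%N /\ D (- m%:Z) != 0]).
Proof.
move=> r0 hf hg; have hb := holomorphic_taylor hg; set b := taylor_coef g in hb.
have DE k : D k = laurent_of_taylor N b k.
  exact: (laurent_coef_eq k (laurent_expansion_quot r0 hf hb)).
have DN m : (m <= N)%N -> D (- m%:Z) = b (N - m)%N.
  move=> mN; rewrite DE /laurent_of_taylor ifF; last by lia.
  by congr b; lia.
have DN0 m : (N < m)%N -> D (- m%:Z) = 0.
  by move=> mN; rewrite DE /laurent_of_taylor ifT//; lia.
have quotE d t : t != 0 -> (forall k, (k < d)%N -> b k = 0) -> g t = t ^+ d * taylor_quot g b d t.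
  move=> t0 hd; rewrite {1}(taylor_quotE d t (has_taylor0 hb)) big1 ?add0r//.
  by move=> k _; rewrite hd ?mul0r.
have [ex|none] := pselect (exists d, (d < N)%N && (b d != 0)); last first.
  have b0 k : (k < N)%N -> b k = 0.
    by move=> kN; apply/eqP/negPn/negP => bk; apply: none; exists k; rewrite kN.
  rewrite nat_max0; last first.
    move=> m [m1]; have [mN|mN] := leqP m N; last by rewrite DN0 ?eqxx.
    by rewrite DN// b0 ?eqxx//; lia.
  exists (taylor_quot g b N); first exact: holomorphic_taylor_quot.
  apply/near0_cmodP; exists r => // t t0 tr; rewrite hf// (quotE N)//.
  by rewrite mulrC mulKf// expf_neq0.
have [d /andP[dN bd] hmin] := ex_minnP ex.
have b0 k : (k < d)%N -> b k = 0.
  move=> kd; apply/eqP/negPn/negP => bk; have := hmin k; rewrite bk andbT.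
  by move=> /(_ (ltn_trans kd dN)); rewrite leqNgt kd.
rewrite (@nat_max_eq _ (N - d)%N); last first.
- move=> m [m1]; have [mN|mN] := leqP m N; last by rewrite DN0 ?eqxx.
  rewrite DN// => bm; have := hmin (N - m)%N; rewrite bm andbT; lia.
- split; first by lia.
  by rewrite DN ?leq_subr// subKn// ltnW.
have Nd : (N - d)%N = (N - d).-1.+1 by lia.
rewrite Nd /=; exists (taylor_quot g b d); split.
- exact: holomorphic_taylor_quot.
- by rewrite /taylor_quot eqxx.
apply/near0_cmodP; exists r => // t t0 tr; rewrite hf// (quotE d)// -Nd.
rewrite (_ : t ^+ N = t ^+ d * t ^+ (N - d)); last by rewrite -exprD subnKC// ltnW.
by rewrite invfM mulrACA divff ?expf_neq0// mul1r.
Qed.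

(** A zero of order [d] shifts the coefficients by [d], so those below [d] vanish; uniqueness of the
    expansion turns this into a bound on [d]. *)
Lemma taylor_coef_zero_order g k : hol0 g -> taylor_coef g k != 0 ->
  exists2 d, zero_order (g : Cplx R -> Cplx R) = Some d & (d <= k)%N.
Proof.
move=> hg gk; have hb := holomorphic_taylor hg; rewrite /zero_order.
case: asboolP => [/near_cmodP [r r0 h]|_].
  case/eqP: gk.
  have h0 : has_taylor g (fun=> 0).
    apply: (@has_taylor_near _ (fun=> 0) _ _ r) => // [w wr|].
      by rewrite h// subr0.
    exists 1, 0; split=> // w _ n; rewrite mul0r big1 ?subrr ?cmod0//.
    by move=> j _; rewrite mul0r.
  exact: (has_taylor_uniq hb h0).
eexists; first by [].
(* The default value 0 of [xget] satisfies the bound at once. *)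
case: xgetP => [d _ [h [hh h0 /near_cmodP [r r0 hr]]]|_//].
rewrite leqNgt; apply/negP => kd; case/eqP: gk.
have hg' := has_taylor_mulXn d (holomorphic_taylor hh).
have hg'' : has_taylor g (fun k => if (k < d)%N then 0 else taylor_coef h (k - d)%N).
  by apply: has_taylor_near r0 _ hg' => w wr; rewrite hr// subr0.
by rewrite (has_taylor_uniq hb hg'') kd.
Qed.

End Laurent.

(** * Restriction of the local normal form to a line *)

Section FlagsOnLine.
Variables (R : realType) (r : nat) (Phi : seq 'rV[R]_r) (Delta : r.-tuple 'rV[R]_r).
Local Notation V := (zeta_space R Phi Delta).
Local Notation hol0 f := (@holomorphic_at R (Cplx R) f 0).
Implicit Types (s v : V) (w : carrier r) (F : flag r).

(* A flag has increasing, hence distinct, supports, and incidence determines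
   each level from its support. *)
Lemma finite_incident_flags s0 : finite_set (incident_flags s0).
Proof.
pose l (U : {set 'I_r}) : nat := xget 0%N [set k | Lambda (U, k) s0 = 0].
have lP w : incident s0 w -> w = (w.1, l w.1).
  case: w => U k [_ /= h]; congr pair; rewrite /l; case: xgetP => [m _ /= hm|/(_ k)//].
  move: h; rewrite -hm /Lambda /= => /addrI /eqP.
  by rewrite eqr_nat => /eqP.
pose T : finType := {set 'I_r}.
pose mk (p : #|T|.-bseq T) : flag r := [seq (U, l U) | U <- p].
apply: (@sub_finite_set _ _ (mk @` setT)); last exact/finite_image/finite_finset.
move=> F [[_ _ srt] inc].
have srt' : sorted (fun A B : {set 'I_r} => A \proper B) [seq w.1 | w <- F].
  by rewrite sorted_map.
have un : uniq [seq w.1 | w <- F].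
  apply: sorted_uniq srt' => [A B D|A]; first exact: fintype.proper_trans.
  by rewrite fintype.properxx.
have sz : (size [seq w.1 | w <- F] <= #|T|)%N.
  by rewrite -(card_uniqP un) max_card.
exists (Bseq sz) => //; rewrite /mk /= -map_comp -[RHS]map_id.
by apply/eq_in_map => w /inc /lP /= <-.
Qed.

Lemma Lambda_line s0 v w (t : R[i]) :
  Lambda w (line s0 v t) = Lambda w s0 + t * cslope s0 v w :> R[i].
Proof.
pose d : R[i] := \sum_(j in Rset Phi Delta w.1) v 0 j.
have E (x : R[i]) : Lambda w (line s0 v x) = Lambda w s0 + x * d :> R[i].
  rewrite /Lambda /line /d mulr_sumr.
  under eq_bigr do rewrite !mxE.
  by rewrite big_split /= -!addrA; congr (_ + _); rewrite addrC -!addrA.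
rewrite E; congr (_ + _ * _); rewrite /cslope; apply/esym/cderiv_derive1.
move=> e e0; exists 1 => // z _; rewrite !E.
rewrite (_ : _ - _ - _ = 0); first by rewrite cmod0 mulr_ge0 ?cmod_ge0 ?ltW.
by rewrite subr0 mul0r; ring.
Qed.

Lemma differentiable_line s0 v (t : Cplx R) : differentiable (line s0 v) t.
Proof.
have [h _] := @is_diff_scalel R[i] _ t v.
refine (@differentiableD R[i] _ _ (cst s0) (fun x : Cplx R => x *: v) t _ h).
exact: differentiable_cst.
Qed.

Lemma holomorphic_line (f : V -> Cplx R) s0 v : holomorphic_at f s0 ->
  hol0 (fun t => f (line s0 v t)).
Proof.
rewrite /holomorphic_at => hf.
have l0 : line s0 v 0 = s0 by rewrite /line scale0r addr0.
have hc : line s0 v t @[t --> (0 : Cplx R)] --> s0.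
  by rewrite -{2}l0; exact/differentiable_continuous/differentiable_line.
have hn : \forall t \near (0 : Cplx R), differentiable f (line s0 v t) := hc _ hf.
have [d d0 h] := (near_cmodP _ _).1 hn.
apply: (near_cmodP _ _).2; exists d; first by [].
move=> t td; have ht := h t td.
exact: (differentiable_comp (differentiable_line s0 v t) ht).
Qed.

Lemma prod_Lambda_line s0 v F (t : R[i]) : (forall w, w \in F -> incident s0 w) ->
  \prod_(w <- F) Lambda w (line s0 v t) =
  t ^+ size F * \prod_(w <- F) cslope s0 v w :> R[i].
Proof.
elim: F => [|w F IH] h; first by rewrite !big_nil mulr1.
rewrite !big_cons IH; last by move=> u uF; apply: h; rewrite in_cons uF orbT.
have [_ w0] := h w (mem_head _ _).
have -> : Lambda w (line s0 v t) = t * cslope s0 v w :> R[i].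
  by rewrite Lambda_line; move: w0 => /= ->; rewrite add0r.
by rewrite /= exprS mulrACA.
Qed.

End FlagsOnLine.

Section NormalFormOnLine.
Variables (R : realType) (r : nat) (Phi : seq 'rV[R]_r) (Delta : r.-tuple 'rV[R]_r).
Local Notation V := (zeta_space R Phi Delta).
Local Notation hol0 f := (@holomorphic_at R (Cplx R) f 0).
Variables (Z H : V -> Cplx R) (s0 v : V) (Cf : flag r -> V -> Cplx R).
Hypothesis htr : transverse s0 v.
Hypothesis hnf : local_normal_form Z s0 H Cf.
Implicit Types F : flag r.

Let Fs : seq (flag r) := finmap.enum_fset (fset_set (incident_flags s0)).
Let slopes F : R[i] := \prod_(w <- F) cslope s0 v w.
Let N := \max_(F <- Fs) size F.
Let onl (f : V -> Cplx R) (t : R[i]) : R[i] := f (line s0 v t).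
(* [G t = t ^+ N * Z (line s0 v t)] for small [t != 0]. *)
Let G (t : R[i]) : R[i] := 1 * (t ^+ N * onl H t) +
  \sum_(F <- Fs) (slopes F)^-1 * (t ^+ (N - size F) * onl (Cf F) t).

Lemma mem_incident_flags F : F \in Fs -> incident_flags s0 F.
Proof.
rewrite /Fs in_fset_set; last exact: finite_incident_flags.
by rewrite inE.
Qed.

Lemma size_incident_flag F : F \in Fs -> (size F <= N)%N.
Proof. by move=> h; rewrite /N (big_rem F)/= ?leq_maxl. Qed.

Lemma slopes_neq0 F : F \in Fs -> slopes F != 0.
Proof.
move=> /mem_incident_flags [_ h]; rewrite /slopes prodf_seq_neq0.
by apply/allP => w /h; exact: htr.
Qed.

Lemma holomorphic_coef_line F : F \in Fs -> hol0 (onl (Cf F)).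
Proof.
by move=> /mem_incident_flags h; case: hnf => _ hC _; exact: (holomorphic_line v (hC F h)).
Qed.

Lemma holomorphic_cleared : hol0 G.
Proof.
case: hnf => hH hC _.
apply: holomorphic_at0D; first exact: (holomorphic_at0_mul_poly _ _ (holomorphic_line v hH)).
by apply: holomorphic_at0_sum => F /holomorphic_coef_line; exact: holomorphic_at0_mul_poly.
Qed.

Lemma taylor_cleared : has_taylor G (fun k =>
  1 * (if (k < N)%N then 0 else taylor_coef (onl H) (k - N)%N) +
  \sum_(F <- Fs) (slopes F)^-1 * (if (k < N - size F)%N then 0
     else taylor_coef (onl (Cf F)) (k - (N - size F))%N)).
Proof.
case: hnf => hH hC _; apply: has_taylorD.
  apply: has_taylorZ; apply: has_taylor_mulXn.
  exact: (holomorphic_taylor (holomorphic_line v hH)).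
apply: has_taylor_sum => F hF; apply: has_taylorZ; apply: has_taylor_mulXn.
exact: (holomorphic_taylor (holomorphic_coef_line hF)).
Qed.

(** By transversality a point of the line with [t != 0] lies off every incident carrier, so the
    normal form can be evaluated there. *)
Lemma pullbackE : exists2 d : R, 0 < d & forall t : R[i], t != 0 -> cmod t < d ->
  (Z (line s0 v t) : R[i]) = G t / t ^+ N.
Proof.
case: hnf => _ _ hZ.
have l0 : line s0 v 0 = s0 by rewrite /line scale0r addr0.
have hc : line s0 v t @[t --> (0 : Cplx R)] --> s0.
  by rewrite -{2}l0; exact/differentiable_continuous/differentiable_line.
have hn : \forall t \near (0 : Cplx R),
    (forall w, incident s0 w -> Lambda w (line s0 v t) != 0) ->
    Z (line s0 v t) = H (line s0 v t) + \sum_(F \in incident_flags s0)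
      Cf F (line s0 v t) / \prod_(w <- F) Lambda w (line s0 v t) := hc _ hZ.
have [d d0 h] := (near_cmodP _ _).1 hn; exists d; first by [].
move=> t t0 td.
rewrite h ?subr0//; last first.
  move=> w hw; have := Lambda_line s0 v w t; case: (hw) => _ ->; rewrite add0r => ->.
  by rewrite mulf_neq0//; exact: htr.
rewrite fsbig_finite; last exact: finite_incident_flags.
have tN : t ^+ N != 0 by rewrite expf_neq0.
rewrite /G mulrDl mul1r mulrAC divff// mul1r mulr_suml; congr (_ + _).
apply: eq_big_seq => F hF; rewrite prod_Lambda_line; last by case: (mem_incident_flags hF).
have cF := slopes_neq0 hF; have tF : t ^+ size F != 0 by rewrite expf_neq0.
rewrite -/(slopes F) (_ : t ^+ N = t ^+ (N - size F) * t ^+ size F); last first.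
  by rewrite -exprD subnK// size_incident_flag.
have tNF : t ^+ (N - size F) != 0 by rewrite expf_neq0.
rewrite -/(onl (Cf F) t).
move: (t ^+ (N - size F)) (t ^+ size F) (slopes F) (onl (Cf F) t) tNF tF cF => a b c x *.
by field; apply/and3P.
Qed.

Let pullback : Cplx R -> Cplx R := fun t => Z (line s0 v t).

Lemma laurent_pullback : exists a, laurent_expansion pullback a.
Proof.
have [d d0 hd] := pullbackE.
by eexists; exact: (laurent_expansion_quot d0 hd taylor_cleared).
Qed.

Lemma aggregateE m : aggregate s0 v Cf m = \sum_(F <- Fs)
  (if (m <= size F)%N then (slopes F)^-1 * taylor_coef (onl (Cf F)) (size F - m) else 0) :> R[i].
Proof.
rewrite /aggregate fsbig_mkcondr fsbig_finite; last exact: finite_incident_flags.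
apply: eq_bigr => F _; have -> : (F \in [set F0 : flag r | (m <= size F0)%N]) = (m <= size F)%N.
  by apply/idP/idP; rewrite inE.
case: ifP => // _.
by rewrite /taylor_coef -/(slopes F) invfM mulrA mulrC.
Qed.

(** The coefficient sought is that of index [N - m] in [G]. The part from [H] starts at index [N],
    out of reach as [m >= 1]; the part from [F] is shifted by [N - size F], which leaves index
    [size F - m], or nothing when [F] is shorter than [m]. *)
Lemma laurent_coef_pullback m : (1 <= m)%N ->
  laurent_coef pullback (- m%:Z) = aggregate s0 v Cf m.
Proof.
move=> m1; have [d d0 hd] := pullbackE.
rewrite (laurent_coef_eq _ (laurent_expansion_quot d0 hd taylor_cleared)) aggregateE.
rewrite /laurent_of_taylor; have [Nm|mN] := ltnP N m.
  rewrite ifT; last by lia.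
  rewrite big_seq big1// => F hF; rewrite leqNgt.
  by rewrite (leq_ltn_trans (size_incident_flag hF) Nm).
rewrite ifF; last by lia.
have -> : absz (- m%:Z + N%:Z) = (N - m)%N by lia.
rewrite ifT ?mulr0 ?add0r; last by lia.
apply: eq_big_seq => F hF; have sF := size_incident_flag hF.
have [Fm|mF] := leqP m (size F).
  rewrite ltnNge leq_sub2l//=; congr (_ * taylor_coef _ _).
  by rewrite subnAC subKn.
by rewrite ltn_sub2l ?mulr0// (leq_trans mF).
Qed.

Lemma pole_order_pullback :
  has_pole_order pullback (nat_max [set m | (1 <= m)%N /\ aggregate s0 v Cf m != 0]).
Proof.
have [d d0 hd] := pullbackE.
have := pole_order_quot d0 hd holomorphic_cleared.
congr (has_pole_order pullback (nat_max _)); apply/funext => m; apply/propext => /=.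
by split=> -[m1]; [rewrite laurent_coef_pullback|rewrite -laurent_coef_pullback].
Qed.

(** A nonzero sum has a nonzero summand: some [Cf F] has a nonzero Taylor coefficient of index
    [size F - m] on the line, so its vanishing order is at most [size F - m]. *)
Lemma aggregate_le_excess m : (1 <= m)%N -> aggregate s0 v Cf m != 0 ->
  (m <= max_excess s0 v Cf)%N.
Proof.
move=> m1 Am.
have [F [hF mF cF]] : exists F, [/\ F \in Fs, (m <= size F)%N &
    taylor_coef (onl (Cf F)) (size F - m) != 0].
  apply: contrapT => none; case/eqP: Am; rewrite [LHS]aggregateE big_seq big1// => F hF.
  case: ifP => // mF; apply/eqP; rewrite mulf_eq0; apply/orP; right.
  by apply/negPn/negP => cF; apply: none; exists F.
have [d hd dF] := taylor_coef_zero_order (holomorphic_coef_line hF) cF.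
have ex : flag_excess s0 v Cf F = (size F - d)%N by rewrite /flag_excess hd.
(* This bound makes [max_excess] an attained maximum instead of the default value of [nat_max]. *)
have bnd k : [set flag_excess s0 v Cf E | E in incident_flags s0] k -> (k <= N)%N.
  move=> [E hE <-]; have hE' : E \in Fs.
    rewrite /Fs; have := @in_fset_set _ _ (finite_incident_flags s0) E.
    by rewrite mem_set.
  apply: leq_trans (size_incident_flag hE'); rewrite /flag_excess.
  by case: zero_order => // n; rewrite leq_subr.
have [_ hmax] := nat_max_bounded bnd (ex_intro2 _ _ F (mem_incident_flags hF) erefl).
apply: leq_trans (hmax _ (ex_intro2 _ _ F (mem_incident_flags hF) erefl)).
by rewrite ex; lia.
Qed.

Lemma aggregate_bounded m : aggregate s0 v Cf m != 0 -> (m <= N)%N.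
Proof.
move=> Am; rewrite leqNgt; apply/negP => Nm; case/eqP: Am.
rewrite [LHS]aggregateE big_seq big1// => F hF.
by rewrite leqNgt (leq_ltn_trans (size_incident_flag hF) Nm).
Qed.

Lemma nat_max_aggregate m (S := [set m | (1 <= m)%N /\ aggregate s0 v Cf m != 0]) :
  S m -> S (nat_max S) /\ forall k, S k -> (k <= nat_max S)%N.
Proof. by apply: (@nat_max_bounded _ N) => k [_]; exact: aggregate_bounded. Qed.

End NormalFormOnLine.

Theorem theorem5p4 (R : realType) (r : nat)
  (Phi : seq 'rV[R]_r) (Delta : r.-tuple 'rV[R]_r)
  (hPhi : root_system Phi) (hirr : irreducible_roots Phi)
  (hDelta : simple_system Phi Delta)
  (Z : zeta_space R Phi Delta -> Cplx R)
  (hZ : zeta_continuation Z)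
  (s0 v : zeta_space R Phi Delta)
  (htr : transverse s0 v)
  (H : zeta_space R Phi Delta -> Cplx R)
  (Cf : flag r -> zeta_space R Phi Delta -> Cplx R)
  (hnf : local_normal_form Z s0 H Cf) :
  let f : Cplx R -> Cplx R := fun t => Z (line s0 v t) in
  let A := aggregate s0 v Cf in
  let M := max_excess s0 v Cf in
  [/\ (exists a, laurent_expansion f a) /\
        (forall m : nat, (1 <= m)%N -> laurent_coef f (- m%:Z) = A m),
      has_pole_order f (pole_order f) /\
        pole_order f = nat_max [set m | (1 <= m)%N /\ A m != 0],
      (forall m : nat, (1 <= m)%N -> A m = 0) ->
        extends_holomorphically f /\ pole_order f = 0%N,
      (pole_order f <= M)%N &
      (1 <= M)%N -> (pole_order f = M <-> A M != 0)].
Proof.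
move=> f A M.
have hpole : has_pole_order f (nat_max [set m | (1 <= m)%N /\ A m != 0]).
  exact: (pole_order_pullback htr hnf).
have poleE : pole_order f = nat_max [set m | (1 <= m)%N /\ A m != 0].
  exact: pole_order_eq hpole.
have pole0 : (forall m, (1 <= m)%N -> A m = 0) -> pole_order f = 0%N.
  move=> A0; rewrite poleE; apply: nat_max0 => m [m1].
  by rewrite A0 ?eqxx.
(* If some aggregate is nonzero, the pole order is itself an index with a nonzero aggregate, to
   which [aggregate_le_excess] applies; otherwise it is 0. *)
have poleM : (pole_order f <= M)%N.
  have [[m [m1 Am]]|none] := pselect (exists m, (1 <= m)%N /\ A m != 0).
    have [[n1 An] _] := @nat_max_aggregate _ _ _ _ s0 v Cf _ (conj m1 Am).
    by rewrite poleE; exact: (aggregate_le_excess hnf n1 An).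
  rewrite pole0// => m m1; apply/eqP/negPn/negP => Am.
  by apply: none; exists m.
split.
- split; first exact: (laurent_pullback htr hnf).
  by move=> m m1; exact: (laurent_coef_pullback htr hnf m1).
- by rewrite poleE.
- move=> A0; have p0 := pole0 A0; split; last by [].
  by have := hpole; rewrite -poleE p0.
- exact: poleM.
(* A pole order equal to [M >= 1] is an attained maximum, since with all aggregates zero the order
   would be 0. Conversely a nonzero [A M] puts [M] among the indices maximised over, hence below the
   pole order. *)
- move=> M1; split=> [pM|AM].
    have [[m [m1 Am]]|none] := pselect (exists m, (1 <= m)%N /\ A m != 0).
      have [[_ An] _] := @nat_max_aggregate _ _ _ _ s0 v Cf _ (conj m1 Am).
      by rewrite -pM poleE.
    move: M1; rewrite -pM pole0// => m m1; apply/eqP/negPn/negP => Am.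
    by apply: none; exists m.
  apply/eqP; rewrite eqn_leq poleM /= poleE.
  by have [_ h] := @nat_max_aggregate _ _ _ _ s0 v Cf _ (conj M1 AM); exact: h.
Qed.
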